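(* Let $\mathcal{A}$ and $\mathcal{B}$ be abelian categories with enough projective and enough injective objects, let $T:\mathcal{B}\to\mathcal{A}$ be a right exact covariant functor and $G:\mathcal{A}\to\mathcal{B}$ a left exact covariant functor, let $\mathcal{X},\mathcal{M}$ be classes of objects in $\mathcal{A}$ and $\mathcal{Y},\mathcal{N}$ classes of objects in $\mathcal{B}$, and let $n\geqslant 1$ be an integer. (1) Suppose that the comma category $(\mathcal{B}\downarrow G)$ has enough projective objects, $(\mathcal{X},\mathcal{M})$ is a left $n$-cotorsion pair in $\mathcal{A}$, and $(\mathcal{Y},\mathcal{N})$ is a left $n$-cotorsion pair in $\mathcal{B}$. If $(\mathrm{R}^jG)M=0$ for each $1\leqslant j\leqslant n$ and any $M\in\mathcal{M}$, the class $\begin{pmatrix}\mathcal{X}\\ \mathcal{Y}\end{pmatrix}$ of objects of $(\mathcal{B}\downarrow G)$ is resolving, and $(\mathfrak{D}_{\mathcal{N}}^{\mathcal{M}})_{n-1}^{\wedge}$ is closed under extensions, then $\left(\begin{pmatrix}\mathcal{X}\\ \mathcal{Y}\end{pmatrix},\mathfrak{D}_{\mathcal{N}}^{\mathcal{M}}\right)$ is a left $n$-cotorsion pair in $(\mathcal{B}\downarrow G)$. (2) Suppose that the comma category $(T\downarrow\mathcal{A})$ has enough injective objects, $(\mathcal{X},\mathcal{M})$ is a right $n$-cotorsion pair in $\mathcal{A}$, and $(\mathcal{Y},\mathcal{N})$ is a right $n$-cotorsion pair in $\mathcal{B}$. If $(\mathrm{L}_jT)Y=0$ for each $1\leqslant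 j\leqslant n$ and any $Y\in\mathcal{Y}$, the class $\begin{pmatrix}\mathcal{M}\\ \mathcal{N}\end{pmatrix}$ of objects of $(T\downarrow\mathcal{A})$ is coresolving, and $(\mathfrak{B}_{\mathcal{Y}}^{\mathcal{X}})_{n-1}^{\vee}$ is closed under extensions, then $\left(\mathfrak{B}_{\mathcal{Y}}^{\mathcal{X}},\begin{pmatrix}\mathcal{M}\\ \mathcal{N}\end{pmatrix}\right)$ is a right $n$-cotorsion pair in $(T\downarrow\mathcal{A})$.
   Context: All classes of objects in $\mathcal{A}$ and $\mathcal{B}$ contain the zero object and are closed under isomorphisms. Comma categories. Objects of $(T\downarrow\mathcal{A})$ are triples $\begin{pmatrix}A\\ B\end{pmatrix}_{\varphi}$ with $A\in\mathcal{A}$, $B\in\mathcal{B}$, $\varphi:T(B)\to A$; morphisms to $\begin{pmatrix}A'\\ B'\end{pmatrix}_{\varphi'}$ are pairs $(a:A\to A',\,b:B\to B')$ with $\varphi' T(b)=a\varphi$. Objects of $(\mathcal{B}\downarrow G)$ are triples $\begin{pmatrix}A\\ B\end{pmatrix}_{\phi}$ with $\phi:B\to G(A)$; morphisms are pairs $(a,b)$ with $\phi' b=G(a)\phi$. Both are abelian, and a sequence in either is exact iff it is exact in both components. Classes. $\begin{pmatrix}\mathcal{P}\\ \mathcal{Q}\end{pmatrix}$ is the class of objects of the comma category in question with first component in $\mathcal{P}$ and second component in $\mathcal{Q}$. $\mathfrak{B}_{\mathcal{Y}}^{\mathcal{X}}$ is the class of $\begin{pmatrix}X\\ Y\end{pmatrix}_{\varphi}\in(T\downarrow\mathcal{A})$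 with $Y\in\mathcal{Y}$, $\varphi$ a monomorphism and $\mathrm{Coker}\,\varphi\in\mathcal{X}$. $\mathfrak{D}_{\mathcal{N}}^{\mathcal{M}}$ is the class of $\begin{pmatrix}M\\ N\end{pmatrix}_{\phi}\in(\mathcal{B}\downarrow G)$ with $M\in\mathcal{M}$, $\phi$ an epimorphism and $\mathrm{Ker}\,\phi\in\mathcal{N}$. $\mathrm{L}_jT$ and $\mathrm{R}^jG$ are the $j$-th left, resp. right, derived functors. A class is resolving (resp. coresolving) if it is closed under extensions and kernels of epimorphisms (resp. extensions and cokernels of monomorphisms). For a class $\mathcal{C}$ of objects of an abelian category and $m\geqslant 0$: $\mathcal{C}_m^{\wedge}$ is the class of objects $A$ admitting an exact sequence $0\to C_k\to\cdots\to C_0\to A\to 0$ with all $C_i\in\mathcal{C}$ and some $k\leqslant m$; $\mathcal{C}_m^{\vee}$ is the class of objects $A$ admitting an exact sequence $0\to A\to C^0\to\cdots\to C^k\to 0$ with all $C^i\in\mathcal{C}$ and some $k\leqslant m$. A pair $(\mathcal{C},\mathcal{D})$ of classes of objects in an abelian category is a left $n$-cotorsion pair if (i) $\mathcal{C}$ is closed under direct summands, (ii) $\mathrm{Ext}^i(C,D)=0$ for all $1\leqslant i\leqslant n$, $C\in\mathcal{C}$, $D\in\mathcal{D}$, and (iii) every object $A$ admits a short exact sequence $0\to K\to C\to A\to 0$ with $C\in\mathcal{C}$, $K\in\mathcal{D}_{n-1}^{\wedge}$. It is a right $n$-cotorsion pair if (i') $\mathcal{D}$ is closed under direct summands, (ii)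 holds, and (iii') every object $A$ admits a short exact sequence $0\to A\to D\to K\to 0$ with $D\in\mathcal{D}$, $K\in\mathcal{C}_{n-1}^{\vee}$. *)

(* Defs.v *)
From HB Require Import structures.
From mathcomp Require Import all_boot ssralg.
From Stdlib Require Import Relation_Operators.

Set Implicit Arguments.
Unset Strict Implicit.
Unset Printing Implicit Defensive.

Import GRing.Theory.
Local Open Scope ring_scope.

(** * Preadditive categories and additive functors *)

Record preadditive := Preadditive {
  obj :> Type;
  hom : obj -> obj -> zmodType;
  idm : forall A, hom A A;
  comp : forall A B C, hom B C -> hom A B -> hom A C;
  compmA : forall A B C D (h : hom C D) (g : hom B C) (f : hom A B),
    comp h (comp g f) = comp (comp h g) f;
  comp1m : forall A B (f : hom A B), comp (idm B) f = f;
  compm1 : forall A B (f : hom A B), comp f (idm A) = f;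
  compmDl : forall A B C (g g' : hom B C) (f : hom A B),
    comp (g + g') f = comp g f + comp g' f;
  compmDr : forall A B C (g : hom B C) (f f' : hom A B),
    comp g (f + f') = comp g f + comp g f' }.

Arguments idm {p} A.

Declare Scope cat_scope.
Delimit Scope cat_scope with cat.
Notation "A ~> B" := (hom A B) (at level 60, no associativity) : cat_scope.
Notation "g ∘ f" := (comp g f) (at level 40, left associativity) : cat_scope.
Local Open Scope cat_scope.

(** On abelian categories every right exact or left exact functor is additive,
    so additivity is built into the structure. *)
Record functor (C D : preadditive) := Functor {
  fobj :> C -> D;
  fmap : forall A B : C, (A ~> B) -> (fobj A ~> fobj B);
  fmap1 : forall A : C, fmap (idm A) = idm (fobj A);
  fmapM : forall (A B E : C) (g : B ~> E) (f : A ~> B),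
    fmap (g ∘ f) = fmap g ∘ fmap f;
  fmapD : forall (A B : C) (f g : A ~> B), fmap (f + g) = fmap f + fmap g }.

Arguments fmap {C D} _ {A B} _.

Definition id_functor (C : preadditive) : functor C C :=
  @Functor C C id (fun _ _ f => f) (fun _ => erefl) (fun _ _ _ _ _ => erefl)
    (fun _ _ _ _ => erefl).

Section Composition.
Context (C : preadditive).

Lemma comp0m (A B D : C) (f : A ~> B) : (0 : B ~> D) ∘ f = 0.
Proof. by apply: (addrI (0 ∘ f)); rewrite -compmDl !addr0. Qed.

Lemma compm0 (A B D : C) (g : B ~> D) : g ∘ (0 : A ~> B) = 0.
Proof. by apply: (addrI (g ∘ 0)); rewrite -compmDr !addr0. Qed.

Lemma compNm (A B D : C) (g : B ~> D) (f : A ~> B) : (- g) ∘ f = - (g ∘ f).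
Proof. by apply: (addrI (g ∘ f)); rewrite -compmDl !subrr comp0m. Qed.

Lemma compmN (A B D : C) (g : B ~> D) (f : A ~> B) : g ∘ (- f) = - (g ∘ f).
Proof. by apply: (addrI (g ∘ f)); rewrite -compmDr !subrr compm0. Qed.

End Composition.

Section FunctorAdditive.
Context (C D : preadditive) (F : functor C D).

Lemma fmap0 (A B : C) : fmap F (0 : A ~> B) = 0.
Proof. by apply: (addrI (fmap F 0)); rewrite -fmapD !addr0. Qed.

Lemma fmapN (A B : C) (f : A ~> B) : fmap F (- f) = - fmap F f.
Proof. by apply: (addrI (fmap F f)); rewrite -fmapD !subrr fmap0. Qed.

End FunctorAdditive.

(** * Abelian categories *)

Section Abelian.
Context (C : preadditive).

Definition zero_object (Z : C) : Prop :=
  (forall A (f : A ~> Z), f = 0) /\ (forall A (f : Z ~> A), f = 0).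

Definition is_iso (A B : C) (f : A ~> B) : Prop :=
  exists g : B ~> A, g ∘ f = idm A /\ f ∘ g = idm B.

Definition mono (A B : C) (f : A ~> B) : Prop :=
  forall (W : C) (u v : W ~> A), f ∘ u = f ∘ v -> u = v.

Definition epi (A B : C) (f : A ~> B) : Prop :=
  forall (W : C) (u v : B ~> W), u ∘ f = v ∘ f -> u = v.

Definition is_kernel (A B : C) (f : A ~> B) (K : C) (k : K ~> A) : Prop :=
  f ∘ k = 0 /\
  forall (W : C) (u : W ~> A), f ∘ u = 0 -> exists! v : W ~> K, k ∘ v = u.

Definition is_cokernel (A B : C) (f : A ~> B) (Q : C) (q : B ~> Q) : Prop :=
  q ∘ f = 0 /\
  forall (W : C) (u : B ~> W), u ∘ f = 0 -> exists! v : Q ~> W, v ∘ q = u.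

Definition is_biproduct (A B S : C) (i1 : A ~> S) (i2 : B ~> S)
    (p1 : S ~> A) (p2 : S ~> B) : Prop :=
  [/\ p1 ∘ i1 = idm A, p2 ∘ i2 = idm B, p1 ∘ i2 = 0, p2 ∘ i1 = 0
    & i1 ∘ p1 + i2 ∘ p2 = idm S].

Record abelian : Prop := Abelian {
  abelian_zero : exists Z : C, zero_object Z;
  abelian_biproduct : forall A B : C,
    exists (S : C) (i1 : A ~> S) (i2 : B ~> S) (p1 : S ~> A) (p2 : S ~> B),
      is_biproduct i1 i2 p1 p2;
  abelian_kernel : forall (A B : C) (f : A ~> B),
    exists (K : C) (k : K ~> A), is_kernel f k;
  abelian_cokernel : forall (A B : C) (f : A ~> B),
    exists (Q : C) (q : B ~> Q), is_cokernel f q;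
  abelian_mono : forall (A B : C) (f : A ~> B), mono f ->
    exists (D : C) (g : B ~> D), is_kernel g f;
  abelian_epi : forall (A B : C) (f : A ~> B), epi f ->
    exists (D : C) (g : D ~> A), is_cokernel g f }.

(** Exactness of A -> B -> D at B: the image of f, i.e. the mono part of an
    epi-mono factorization of f, is a kernel of g. *)
Definition exact (A B D : C) (f : A ~> B) (g : B ~> D) : Prop :=
  exists (K : C) (k : K ~> B) (e : A ~> K),
    [/\ is_kernel g k, epi e & f = k ∘ e].

Definition short_exact (A B D : C) (f : A ~> B) (g : B ~> D) : Prop :=
  [/\ mono f, exact f g & epi g].

Definition projective (P : C) : Prop :=
  forall (A B : C) (p : A ~> B) (f : P ~> B), epi p ->
    exists h : P ~> A, p ∘ h = f.

Definition injective_object (I : C) : Prop :=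
  forall (A B : C) (i : A ~> B) (f : A ~> I), mono i ->
    exists h : B ~> I, h ∘ i = f.

Definition enough_projectives : Prop :=
  forall A : C, exists (P : C) (p : P ~> A), projective P /\ epi p.

Definition enough_injectives : Prop :=
  forall A : C, exists (I : C) (i : A ~> I), injective_object I /\ mono i.

(** [... -> X 1 -> X 0 -> A -> 0] is exact; finite sequences are those with
    [X i] zero from some point on. *)
Definition left_exact_seq (A : C) (X : nat -> C)
    (d : forall i, X i.+1 ~> X i) (e : X 0 ~> A) : Prop :=
  [/\ epi e, exact (d 0%N) e & forall i, exact (d i.+1) (d i)].

(** [0 -> A -> X 0 -> X 1 -> ...] is exact. *)
Definition right_exact_seq (A : C) (X : nat -> C)
    (d : forall i, X i ~> X i.+1) (e : A ~> X 0) : Prop :=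
  [/\ mono e, exact e (d 0%N) & forall i, exact (d i) (d i.+1)].

(** ** Classes of objects *)

Definition object_class (P : C -> Prop) : Prop :=
  (forall Z, zero_object Z -> P Z) /\
  (forall (A B : C) (f : A ~> B), is_iso f -> P A -> P B).

Definition closed_extensions (P : C -> Prop) : Prop :=
  forall (A B D : C) (f : A ~> B) (g : B ~> D),
    short_exact f g -> P A -> P D -> P B.

Definition closed_epi_kernels (P : C -> Prop) : Prop :=
  forall (A B D : C) (f : A ~> B) (g : B ~> D),
    short_exact f g -> P B -> P D -> P A.

Definition closed_mono_cokernels (P : C -> Prop) : Prop :=
  forall (A B D : C) (f : A ~> B) (g : B ~> D),
    short_exact f g -> P A -> P B -> P D.

Definition closed_summands (P : C -> Prop) : Prop :=
  forall (A B S : C) (i1 : A ~> S) (i2 : B ~> S) (p1 : S ~> A) (p2 : S ~> B),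
    is_biproduct i1 i2 p1 p2 -> P S -> P A.

Definition resolving (P : C -> Prop) : Prop :=
  closed_extensions P /\ closed_epi_kernels P.

Definition coresolving (P : C -> Prop) : Prop :=
  closed_extensions P /\ closed_mono_cokernels P.

Definition left_dim_le (P : C -> Prop) (m : nat) (A : C) : Prop :=
  exists (k : nat) (X : nat -> C) (d : forall i, X i.+1 ~> X i) (e : X 0 ~> A),
    [/\ (k <= m)%N, left_exact_seq d e,
        forall i, (i <= k)%N -> P (X i)
      & forall i, (k < i)%N -> zero_object (X i)].

Definition right_dim_le (P : C -> Prop) (m : nat) (A : C) : Prop :=
  exists (k : nat) (X : nat -> C) (d : forall i, X i ~> X i.+1) (e : A ~> X 0),
    [/\ (k <= m)%N, right_exact_seq d e,
        forall i, (i <= k)%N -> P (X i)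
      & forall i, (k < i)%N -> zero_object (X i)].

(** ** Yoneda Ext *)

(** An n-extension [0 -> D -> X n.-1 -> ... -> X 0 -> A -> 0] for n >= 1,
    written with an isomorphism from D to [X n] and zeros beyond [X n]. *)
Record extension (n : nat) (A D : C) := Extension {
  ext_obj : nat -> C;
  ext_d : forall i, ext_obj i.+1 ~> ext_obj i;
  ext_aug : ext_obj 0 ~> A;
  ext_end : D ~> ext_obj n;
  ext_exact : left_exact_seq ext_d ext_aug;
  ext_end_iso : is_iso ext_end;
  ext_bounded : forall i, (n < i)%N -> zero_object (ext_obj i) }.

(** Existence of a morphism of n-extensions that is the identity on A and D. *)
Definition extension_mor (n : nat) (A D : C) (x y : extension n A D) : Prop :=
  exists f : forall i, ext_obj x i ~> ext_obj y i,
    [/\ forall i, ext_d y i ∘ f i.+1 = f i ∘ ext_d x i,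
        ext_aug y ∘ f 0%N = ext_aug x
      & f n ∘ ext_end x = ext_end y].

Definition yoneda_equiv (n : nat) (A D : C) :
    extension n A D -> extension n A D -> Prop :=
  clos_refl_sym_trans (extension n A D) (@extension_mor n A D).

(** [Ext^n(A, D) = 0] for n >= 1: the group of Yoneda classes of n-extensions
    is trivial when it has only one element. *)
Definition Ext_zero (n : nat) (A D : C) : Prop :=
  forall x y : extension n A D, yoneda_equiv x y.

(** ** Cotorsion pairs *)

Definition left_cotorsion_pair (n : nat) (P Q : C -> Prop) : Prop :=
  [/\ closed_summands P,
      forall i A D, (1 <= i <= n)%N -> P A -> Q D -> Ext_zero i A D
    & forall A : C, exists (K X : C) (f : K ~> X) (g : X ~> A),
        [/\ short_exact f g, P X & left_dim_le Q n.-1 K]].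

Definition right_cotorsion_pair (n : nat) (P Q : C -> Prop) : Prop :=
  [/\ closed_summands Q,
      forall i A D, (1 <= i <= n)%N -> P A -> Q D -> Ext_zero i A D
    & forall A : C, exists (X K : C) (f : A ~> X) (g : X ~> K),
        [/\ short_exact f g, Q X & right_dim_le P n.-1 K]].

End Abelian.

(** * Exact and derived functors *)

Section Functors.
Context (C D : preadditive) (F : functor C D).

Definition right_exact : Prop :=
  forall (X Y Z : C) (f : X ~> Y) (g : Y ~> Z), short_exact f g ->
    exact (fmap F f) (fmap F g) /\ epi (fmap F g).

Definition left_exact : Prop :=
  forall (X Y Z : C) (f : X ~> Y) (g : Y ~> Z), short_exact f g ->
    mono (fmap F f) /\ exact (fmap F f) (fmap F g).

(** Vanishing of [L_j F] at A: the homology in degree j of F applied to a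
    (deleted) projective resolution of A is zero. *)
Definition left_derived_zero (j : nat) (A : C) : Prop :=
  forall (P : nat -> C) (d : forall i, P i.+1 ~> P i) (e : P 0 ~> A),
    (forall i, projective (P i)) -> left_exact_seq d e ->
    match j with
    | 0 => epi (fmap F (d 0%N))
    | i.+1 => exact (fmap F (d i.+1)) (fmap F (d i))
    end.

Definition right_derived_zero (j : nat) (A : C) : Prop :=
  forall (I : nat -> C) (d : forall i, I i ~> I i.+1) (e : A ~> I 0),
    (forall i, injective_object (I i)) -> right_exact_seq d e ->
    match j with
    | 0 => mono (fmap F (d 0%N))
    | i.+1 => exact (fmap F (d i)) (fmap F (d i.+1))
    end.

End Functors.

(** * Comma categories *)

Section Comma.
Context (C D E : preadditive) (F : functor C E) (H : functor D E).

Record comma_obj := CommaObj {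
  csrc : C;
  ctgt : D;
  cmap : F csrc ~> H ctgt }.

Definition comma_square (X Y : comma_obj) :
    {pred ((csrc X ~> csrc Y) * (ctgt X ~> ctgt Y))%type} :=
  fun p => cmap Y ∘ fmap F p.1 == fmap H p.2 ∘ cmap X.

Lemma comma_square_zmod (X Y : comma_obj) : zmod_closed (@comma_square X Y).
Proof.
split=> [|p q]; rewrite !unfold_in /=.
  by rewrite !fmap0 comp0m compm0.
move=> /eqP hp /eqP hq.
by rewrite !fmapD !fmapN compmDl compNm compmDr compmN hp hq.
Qed.

HB.instance Definition _ (X Y : comma_obj) :=
  GRing.isZmodClosed.Build _ (@comma_square X Y) (@comma_square_zmod X Y).

Record comma_hom (X Y : comma_obj) := CommaHom {
  comma_pair : (csrc X ~> csrc Y) * (ctgt X ~> ctgt Y);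
  comma_pairP : comma_pair \in @comma_square X Y }.

HB.instance Definition _ (X Y : comma_obj) :=
  [isSub for @comma_pair X Y].
HB.instance Definition _ (X Y : comma_obj) :=
  [Choice of comma_hom X Y by <:].
HB.instance Definition _ (X Y : comma_obj) :=
  [SubChoice_isSubZmodule of comma_hom X Y by <:].

Lemma comma_id_subproof (X : comma_obj) :
  (idm (csrc X), idm (ctgt X)) \in @comma_square X X.
Proof. by rewrite unfold_in /= !fmap1 comp1m compm1. Qed.

Definition comma_id (X : comma_obj) : comma_hom X X :=
  CommaHom (comma_id_subproof X).

Lemma comma_comp_subproof (X Y Z : comma_obj)
    (g : comma_hom Y Z) (f : comma_hom X Y) :
  ((comma_pair g).1 ∘ (comma_pair f).1, (comma_pair g).2 ∘ (comma_pair f).2)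
    \in @comma_square X Z.
Proof.
have /eqP hg := comma_pairP g; have /eqP hf := comma_pairP f.
by rewrite unfold_in /= !fmapM compmA hg -compmA hf compmA.
Qed.

Definition comma_comp (X Y Z : comma_obj)
    (g : comma_hom Y Z) (f : comma_hom X Y) : comma_hom X Z :=
  CommaHom (comma_comp_subproof g f).

Lemma comma_homP (X Y : comma_obj) (f g : comma_hom X Y) :
  (comma_pair f).1 = (comma_pair g).1 -> (comma_pair f).2 = (comma_pair g).2 ->
  f = g.
Proof.
move=> h1 h2; apply: val_inj => /=.
by rewrite [LHS]surjective_pairing h1 h2 -surjective_pairing.
Qed.

Definition comma : preadditive.
Proof.
apply: (@Preadditive comma_obj (fun X Y => comma_hom X Y) comma_id comma_comp).
- by move=> X Y Z W h g f; apply: comma_homP; rewrite /= compmA.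
- by move=> X Y f; apply: comma_homP; rewrite /= comp1m.
- by move=> X Y f; apply: comma_homP; rewrite /= compm1.
- by move=> X Y Z g g' f; apply: comma_homP; rewrite /= compmDl.
- by move=> X Y Z g f f'; apply: comma_homP; rewrite /= compmDr.
Defined.

End Comma.

(** [(T ↓ A)]: objects [φ : T B -> A], with [csrc] = B and [ctgt] = A. *)
Definition left_comma (A B : preadditive) (T : functor B A) : preadditive :=
  comma T (id_functor A).

(** [(B ↓ G)]: objects [φ : B -> G A], with [csrc] = B and [ctgt] = A. *)
Definition right_comma (A B : preadditive) (G : functor A B) : preadditive :=
  comma (id_functor B) G.

(** The class of comma objects whose A-component is in P and whose
    B-component is in Q. *)
Definition left_comma_class (A B : preadditive) (T : functor B A)
    (P : A -> Prop) (Q : B -> Prop) : left_comma T -> Prop :=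
  fun X => P (ctgt X) /\ Q (csrc X).

Definition right_comma_class (A B : preadditive) (G : functor A B)
    (P : A -> Prop) (Q : B -> Prop) : right_comma G -> Prop :=
  fun X => P (ctgt X) /\ Q (csrc X).

Definition frakB (A B : preadditive) (T : functor B A)
    (X : A -> Prop) (Y : B -> Prop) : left_comma T -> Prop :=
  fun V => [/\ Y (csrc V), mono (cmap V : T (csrc V) ~> ctgt V)
    & exists (Q : A) (q : ctgt V ~> Q), is_cokernel (cmap V) q /\ X Q].

Definition frakD (A B : preadditive) (G : functor A B)
    (M : A -> Prop) (N : B -> Prop) : right_comma G -> Prop :=
  fun V => [/\ M (ctgt V), epi (cmap V : csrc V ~> G (ctgt V))
    & exists (K : B) (k : K ~> csrc V), is_kernel (cmap V) k /\ N K].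

Arguments left_comma_class {A B} T P Q _.
Arguments right_comma_class {A B} G P Q _.
Arguments frakB {A B} T X Y _.
Arguments frakD {A B} G M N _.

(* Main.v *)
Require Import Defs.
From mathcomp Require Import all_boot ssralg.
From Stdlib Require Import Relation_Operators ClassicalEpsilon.

(** Both halves are one statement read in two categories. The opposite of the
    category of arrows [T b -> a] is the category of arrows [a -> T b] over the
    opposite of [A], so the second half is the first one for opposite
    categories. To have a single proof, the argument is carried out in a category
    [E] that comes with a comparison with the arrows [b -> G a]
    ([comma_presentation]); it is instantiated with [right_comma G] and with the
    opposite of [left_comma T].

    Approximations ([glue_cover]). Let [φ : b -> G a] be an object. Choose
    0 -> K -> X0 -> a -> 0 with [K] resolved by [M]. Dimension shifting along the
    resolution turns the vanishing of the derived functors of [G] on [M] into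
    their vanishing on [K] ([deriv0_shift], [res_dim_deriv0]), so [G X0 -> G a]
    is epi with kernel [G K]. Let [B'] be the pullback of [b] and [G X0] over
    [G a], and choose 0 -> L -> Y0 -> B' -> 0 with [L] resolved by [N]. Then the
    object [Y0 -> G X0] covers [φ], and its kernel is an extension of
    [G K = G K] by [L -> 0]. These two objects are resolved by [frakD G M N]
    ([glue_idm_res], [glue_zero_res]), and so is the kernel, since such objects
    are closed under extensions.

    First extension groups ([glue_splits]). In a sequence
    0 -> (M, N) -> W -> (X, Y) -> 0 the first components split, by a section [s].
    A section of the second components over [s] has to land in the kernel of a
    map [W_2 -> G M] that extends [N -> G M]; as [N -> G M] is epi, this kernel
    is an extension of [Y] by the kernel of [N -> G M], so it splits too.

    Higher extension groups. The approximations show that projective objects of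
    [E] lie in the class of pairs ([glue_projective]), so a resolving class of
    pairs contains all syzygies of its members. For an extension of any length
    one can then map into it a fixed extension, made of projective objects up to
    the last syzygy and split there ([syzygy_ext_over]), so that there is only
    one Yoneda class ([syzygy_Ext_zero]). In the dual situation the second
    argument has cosyzygies instead; the category [left_comma T] has enough
    projective objects ([glue_enough_injectives] in the opposite category), and
    Ext^1 of a syzygy is Ext^1 into a cosyzygy ([syzygy_splits]).

    Diagrams are chased with elements, where an element of an object is a map
    from a projective object ([exact_chase], [exact_lift]): on these, a map is
    epi exactly when it is surjective. *)

Set Implicit Arguments.
Unset Strict Implicit.
Unset Printing Implicit Defensive.

Import GRing.Theory.
Local Open Scope ring_scope.
Local Open Scope cat_scope.

(** * Preadditive and abelian categories *)

Section Preadditive.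
Context (C : preadditive).

Lemma compmB (A B D : C) (g : B ~> D) (f f' : A ~> B) :
  g ∘ (f - f') = g ∘ f - g ∘ f'.
Proof. by rewrite compmDr compmN. Qed.

Lemma compBm (A B D : C) (g g' : B ~> D) (f : A ~> B) :
  (g - g') ∘ f = g ∘ f - g' ∘ f.
Proof. by rewrite compmDl compNm. Qed.

Lemma mono0 (A B : C) (f : A ~> B) :
  (forall W (u : W ~> A), f ∘ u = 0 -> u = 0) -> mono f.
Proof.
move=> h W u v e; apply/eqP; rewrite -subr_eq0; apply/eqP/h.
by rewrite compmB e subrr.
Qed.

Lemma epi0 (A B : C) (f : A ~> B) :
  (forall W (u : B ~> W), u ∘ f = 0 -> u = 0) -> epi f.
Proof.
move=> h W u v e; apply/eqP; rewrite -subr_eq0; apply/eqP/h.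
by rewrite compBm e subrr.
Qed.

Lemma mono_eq0 (A B W : C) (f : A ~> B) (u : W ~> A) :
  mono f -> f ∘ u = 0 -> u = 0.
Proof. by move=> mf e; apply: mf; rewrite e compm0. Qed.

Lemma epi_eq0 (A B W : C) (f : A ~> B) (u : B ~> W) :
  epi f -> u ∘ f = 0 -> u = 0.
Proof. by move=> ef e; apply: ef; rewrite e comp0m. Qed.

Lemma mono_comp (A B D : C) (g : B ~> D) (f : A ~> B) :
  mono g -> mono f -> mono (g ∘ f).
Proof. by move=> mg mf W u v; rewrite -!compmA => /mg/mf. Qed.

Lemma epi_comp (A B D : C) (g : B ~> D) (f : A ~> B) :
  epi g -> epi f -> epi (g ∘ f).
Proof. by move=> eg ef W u v; rewrite !compmA => /ef/eg. Qed.

Lemma epi_compl (A B D : C) (g : B ~> D) (f : A ~> B) : epi (g ∘ f) -> epi g.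
Proof. by move=> e W u v h; apply: e; rewrite !compmA h. Qed.

Lemma mono_compr (A B D : C) (g : B ~> D) (f : A ~> B) :
  mono (g ∘ f) -> mono f.
Proof. by move=> e W u v h; apply: e; rewrite -!compmA h. Qed.

Lemma epi_split (A B : C) (g : A ~> B) (s : B ~> A) : g ∘ s = idm B -> epi g.
Proof. by move=> e W u v h; rewrite -[u]compm1 -[v]compm1 -e !compmA h. Qed.

Lemma mono_split (A B : C) (g : A ~> B) (s : B ~> A) : s ∘ g = idm A -> mono g.
Proof. by move=> e W u v h; rewrite -[u]comp1m -[v]comp1m -e -!compmA h. Qed.

Lemma iso_epi (A B : C) (f : A ~> B) : is_iso f -> epi f.
Proof. by move=> [g [_ /epi_split]]. Qed.

Lemma iso_mono (A B : C) (f : A ~> B) : is_iso f -> mono f.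
Proof. by move=> [g [/mono_split]]. Qed.

Lemma idm_iso (A : C) : is_iso (idm A).
Proof. by exists (idm A); rewrite comp1m. Qed.

Lemma zero_objectP (Z : C) : zero_object Z <-> idm Z = 0.
Proof.
split=> [[h _]|e]; first exact: h.
by split=> A f; [rewrite -[f]comp1m e comp0m | rewrite -[f]compm1 e compm0].
Qed.

Lemma kernel_mono (A B K : C) (f : A ~> B) (k : K ~> A) :
  is_kernel f k -> mono k.
Proof.
move=> [fk h] W u v e; have [|w [_ uw]] := h _ (k ∘ u).
  by rewrite compmA fk comp0m.
by rewrite -(uw u) // -(uw v).
Qed.

Lemma cokernel_epi (A B Q : C) (f : A ~> B) (q : B ~> Q) :
  is_cokernel f q -> epi q.
Proof.
move=> [qf h] W u v e; have [|w [_ uw]] := h _ (u ∘ q).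
  by rewrite -compmA qf compm0.
by rewrite -(uw u) // -(uw v).
Qed.

Lemma kernel_lift (A B K W : C) (f : A ~> B) (k : K ~> A) (u : W ~> A) :
  is_kernel f k -> f ∘ u = 0 -> exists v, k ∘ v = u.
Proof. by move=> [_ h] /h [v [e _]]; exists v. Qed.

Lemma cokernel_lift (A B Q W : C) (f : A ~> B) (q : B ~> Q) (u : B ~> W) :
  is_cokernel f q -> u ∘ f = 0 -> exists v, v ∘ q = u.
Proof. by move=> [_ h] /h [v [e _]]; exists v. Qed.

Lemma mono_kernel (A B K : C) (f : A ~> B) (k : K ~> A) :
  f ∘ k = 0 -> mono k ->
  (forall W (u : W ~> A), f ∘ u = 0 -> exists v, k ∘ v = u) -> is_kernel f k.
Proof.
move=> fk mk h; split=> // W u /h [v e]; exists v; split=> // v' e'.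
by apply: mk; rewrite e.
Qed.

Lemma epi_cokernel (A B Q : C) (f : A ~> B) (q : B ~> Q) :
  q ∘ f = 0 -> epi q ->
  (forall W (u : B ~> W), u ∘ f = 0 -> exists v, v ∘ q = u) -> is_cokernel f q.
Proof.
move=> qf eq h; split=> // W u /h [v e]; exists v; split=> // v' e'.
by apply: eq; rewrite e.
Qed.

Lemma kernel_iso (A B K K' : C) (f : A ~> B) (k : K ~> A) (t : K' ~> K) :
  is_kernel f k -> is_iso t -> is_kernel f (k ∘ t).
Proof.
move=> kk it; have [t' [_ tt']] := it; apply: mono_kernel.
- by case: kk => fk _; rewrite compmA fk comp0m.
- by apply: mono_comp (kernel_mono kk) (iso_mono it).
move=> W u /(kernel_lift kk) [v e]; exists (t' ∘ v).
by rewrite -compmA [t ∘ _]compmA tt' comp1m.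
Qed.

Lemma kernel_unique (A B K K' : C) (f : A ~> B) (k : K ~> A) (k' : K' ~> A) :
  is_kernel f k -> is_kernel f k' -> exists2 t, is_iso t & k' = k ∘ t.
Proof.
move=> hk hk'.
have [t e] := kernel_lift hk (proj1 hk').
have [t' e'] := kernel_lift hk' (proj1 hk).
exists t => //; exists t'; split.
  by apply: (kernel_mono hk'); rewrite compmA e' e compm1.
by apply: (kernel_mono hk); rewrite compmA e e' compm1.
Qed.

Lemma short_exact_kernel (A B D : C) (f : A ~> B) (g : B ~> D) :
  is_kernel g f -> epi g -> short_exact f g.
Proof.
move=> kf eg; split=> //; first exact: kernel_mono kf.
by exists A, f, (idm A); rewrite compm1; split=> //; apply/iso_epi/idm_iso.
Qed.

Lemma exact_eq0 (A B D : C) (f : A ~> B) (g : B ~> D) : exact f g -> g ∘ f = 0.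
Proof. by move=> [K [k [e [[gk _] _ ->]]]]; rewrite compmA gk comp0m. Qed.

Lemma exact_epi (A B D K : C) (f : A ~> B) (g : B ~> D) (k : K ~> B) e :
  exact f g -> is_kernel g k -> f = k ∘ e -> epi e.
Proof.
move=> [K' [k' [e' [hk' ee' ->]]]] hk.
have [t it ->] := kernel_unique hk hk'.
rewrite -compmA => /(kernel_mono hk) <-.
exact: epi_comp (iso_epi it) ee'.
Qed.

Lemma kernel_exact (A B D K : C) (f : A ~> B) (g : B ~> D) (k : K ~> B) e :
  is_kernel g k -> epi e -> f = k ∘ e -> exact f g.
Proof. by move=> hk ee ->; exists K, k, e. Qed.

End Preadditive.

Section Abelian.
Context (C : preadditive) (abC : abelian C).

(** [f] is a kernel of some [g]; as [g] factors through the cokernel [q] of [f],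
    every map that [q] kills is killed by [g]. *)
Lemma mono_is_kernel (A B Q : C) (f : A ~> B) (q : B ~> Q) :
  mono f -> is_cokernel f q -> is_kernel q f.
Proof.
move=> mf hq; have [D [g [gf hg]]] := abelian_mono abC mf.
apply: mono_kernel => //; first by case: hq.
move=> W u qu; have [g' e] := cokernel_lift hq gf.
by have [|v [ev _]] := hg _ u; [rewrite -e -compmA qu compm0 | exists v].
Qed.

Lemma epi_is_cokernel (A B K : C) (g : A ~> B) (k : K ~> A) :
  epi g -> is_kernel g k -> is_cokernel k g.
Proof.
move=> eg hk; have [D [f [gf hf]]] := abelian_epi abC eg.
apply: epi_cokernel => //; first by case: hk.
move=> W u qu; have [f' e] := kernel_lift hk gf.
by have [|v [ev _]] := hf _ u; [rewrite -e compmA qu comp0m | exists v].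
Qed.

Lemma mono_epi_iso (A B : C) (f : A ~> B) : mono f -> epi f -> is_iso f.
Proof.
move=> mf ef; have [Q [q hq]] := abelian_cokernel abC f.
have q0 : q = 0 by apply: (epi_eq0 ef); case: hq.
have [|s es] := kernel_lift (u := idm B) (mono_is_kernel mf hq).
  by rewrite q0 comp0m.
by exists s; split=> //; apply: mf; rewrite compmA es comp1m compm1.
Qed.

Lemma exact_mono_kernel (A B D : C) (f : A ~> B) (g : B ~> D) :
  mono f -> exact f g -> is_kernel g f.
Proof.
move=> mf [K [k [e [hk ee ef]]]]; rewrite ef in mf *.
by apply: kernel_iso hk _; apply: mono_epi_iso (mono_compr mf) ee.
Qed.

Lemma short_exactP (A B D : C) (f : A ~> B) (g : B ~> D) :
  short_exact f g <-> is_kernel g f /\ epi g.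
Proof.
split=> [[mf ex eg]|[kf eg]]; last exact: short_exact_kernel.
by split=> //; apply: exact_mono_kernel.
Qed.

Lemma short_exact_cokernel (A B D : C) (f : A ~> B) (g : B ~> D) :
  short_exact f g -> is_cokernel f g.
Proof. by move=> /short_exactP [kf eg]; apply: epi_is_cokernel. Qed.

Lemma epi_short_exact (A B : C) (g : A ~> B) :
  epi g -> exists (K : C) (k : K ~> A), short_exact k g.
Proof.
move=> eg; have [K [k hk]] := abelian_kernel abC g.
by exists K, k; apply/short_exactP.
Qed.

Lemma mono_short_exact (A B : C) (f : A ~> B) :
  mono f -> exists (Q : C) (q : B ~> Q), short_exact f q.
Proof.
move=> mf; have [Q [q hq]] := abelian_cokernel abC f.
exists Q, q; apply/short_exactP; split; first exact: mono_is_kernel.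
exact: cokernel_epi hq.
Qed.

(** The kernel [k] of [q] is the image of [f]: if [u] kills the factor [e] of [f]
    through [k], then the kernel [j] of [u] gives a smaller mono [k ∘ j] through
    which [f] factors, and this mono is a kernel, so it contains [k]. *)
Lemma exact_cokernel (A B Q : C) (f : A ~> B) (q : B ~> Q) :
  is_cokernel f q -> exact f q.
Proof.
move=> hq; have [K [k hk]] := abelian_kernel abC q.
have [e ek] := kernel_lift hk (proj1 hq).
apply: (kernel_exact hk _ (esym ek)); apply: epi0 => W u ue.
have [J [j hj]] := abelian_kernel abC u.
have [e' ej] := kernel_lift hj ue.
have mkj := mono_comp (kernel_mono hk) (kernel_mono hj).
have [D [h hh]] := abelian_mono abC mkj.
have hf : h ∘ f = 0 by rewrite -ek -ej !compmA -(compmA h) (proj1 hh) comp0m.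
have [h' eh] := cokernel_lift hq hf.
have hk0 : h ∘ k = 0 by rewrite -eh -compmA (proj1 hk) compm0.
have [t et] := kernel_lift hh hk0.
have jt : j ∘ t = idm K by apply: (kernel_mono hk); rewrite compmA et compm1.
by rewrite -[u]compm1 -jt compmA (proj1 hj) comp0m.
Qed.

(** The complement of the section [s] is the retraction [r] with
    [f ∘ r = 1 - s ∘ g]. *)
Lemma split_section (A B D : C) (f : A ~> B) (g : B ~> D) (s : D ~> B) :
  short_exact f g -> g ∘ s = idm D ->
  exists r, is_biproduct s f g r.
Proof.
move=> se gs; have /short_exactP [kf _] := se.
have [|r er] := kernel_lift (u := idm B - s ∘ g) kf.
  by rewrite compmB compmA gs compm1 comp1m subrr.
have mf := kernel_mono kf.
exists r; split=> //.
- by apply: mf; rewrite compmA er compBm -compmA (proj1 kf) compm0 subr0 compm1 comp1m.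
- by case: kf.
- by apply: mf; rewrite compmA er compBm -compmA gs comp1m compm1 subrr compm0.
- by rewrite er addrC subrK.
Qed.

Lemma split_retraction (A B D : C) (f : A ~> B) (g : B ~> D) (r : B ~> A) :
  short_exact f g -> r ∘ f = idm A -> exists s, g ∘ s = idm D.
Proof.
move=> se rf; have cg := short_exact_cokernel se.
have [|s es] := cokernel_lift (u := idm B - f ∘ r) cg.
  by rewrite compBm -compmA rf compm1 comp1m subrr.
exists s; apply: (cokernel_epi cg).
by rewrite -compmA es compmB compmA (proj1 cg) comp0m subr0 compm1 comp1m.
Qed.

(** The pullback is stated as joint monicity of the projections and existence of
    liftings, the two forms in which it is used. *)
Lemma pullback (A B D : C) (f : A ~> D) (g : B ~> D) :
  exists (Q : C) (p : Q ~> A) (q : Q ~> B),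
    [/\ f ∘ p = g ∘ q,
        forall W (u v : W ~> Q), p ∘ u = p ∘ v -> q ∘ u = q ∘ v -> u = v
      & forall W (a : W ~> A) (b : W ~> B), f ∘ a = g ∘ b ->
          exists w, p ∘ w = a /\ q ∘ w = b].
Proof.
have [S [i1 [i2 [p1 [p2 [p1i1 p2i2 p1i2 p2i1 e]]]]]] := abelian_biproduct abC A B.
have [K [k hk]] := abelian_kernel abC (f ∘ p1 - g ∘ p2).
exists K, (p1 ∘ k), (p2 ∘ k); split.
- apply/eqP; rewrite -subr_eq0 !compmA -compBm; apply/eqP; by case: hk.
- move=> W u v; rewrite -!compmA => e1 e2; apply: (kernel_mono hk).
  by rewrite -[k ∘ u]comp1m -[k ∘ v]comp1m -e !compmDl -!compmA e1 e2.
move=> W a b fg; have [|w ew] := kernel_lift (u := i1 ∘ a + i2 ∘ b) hk.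
  rewrite compBm !compmDr -!compmA !(compmA p1) !(compmA p2).
  by rewrite p1i1 p1i2 p2i1 p2i2 !comp1m !comp0m !compm0 addr0 add0r fg subrr.
exists w; rewrite -!compmA ew !compmDr !compmA.
by rewrite p1i1 p1i2 p2i1 p2i2 !comp1m !comp0m addr0 add0r.
Qed.

Context (pC : enough_projectives C).

(** A projective cover of [B] is an element of [B]; if it lifts along [f], then
    [f] is epi. *)
Lemma epi_chase (A B : C) (f : A ~> B) :
  (forall P (y : P ~> B), projective P -> exists x, f ∘ x = y) -> epi f.
Proof.
move=> h; have [P [p [prP ep]]] := pC B; have [x e] := h _ p prP.
by rewrite -e in ep; apply: epi_compl ep.
Qed.

Lemma mono_chase (A B : C) (f : A ~> B) :
  (forall P (x : P ~> A), projective P -> f ∘ x = 0 -> x = 0) -> mono f.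
Proof.
move=> h; apply: mono0 => W u fu; have [P [p [prP ep]]] := pC W.
by apply: (epi_eq0 ep); apply: h => //; rewrite compmA fu comp0m.
Qed.

Lemma exact_chase (A B D : C) (f : A ~> B) (g : B ~> D) :
  g ∘ f = 0 ->
  (forall P (y : P ~> B), projective P -> g ∘ y = 0 -> exists x, f ∘ x = y) ->
  exact f g.
Proof.
move=> gf h; have [K [k hk]] := abelian_kernel abC g.
have [e ek] := kernel_lift hk gf.
apply: (kernel_exact hk _ (esym ek)); apply: epi_chase => P y prP.
have [|x ex] := h _ (k ∘ y) prP; first by rewrite compmA (proj1 hk) comp0m.
by exists x; apply: (kernel_mono hk); rewrite compmA ek.
Qed.

Lemma exact_lift (A B D P : C) (f : A ~> B) (g : B ~> D) (y : P ~> B) :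
  exact f g -> projective P -> g ∘ y = 0 -> exists x, f ∘ x = y.
Proof.
move=> [K [k [e [hk ee ->]]]] prP /(kernel_lift hk) [v <-].
by have [x <-] := prP _ _ e v ee; exists x; rewrite compmA.
Qed.

Lemma ses_chase (A B D : C) (f : A ~> B) (g : B ~> D) :
  g ∘ f = 0 ->
  (forall P (x : P ~> A), projective P -> f ∘ x = 0 -> x = 0) ->
  (forall P (y : P ~> B), projective P -> g ∘ y = 0 -> exists x, f ∘ x = y) ->
  (forall P (z : P ~> D), projective P -> exists y, g ∘ y = z) ->
  short_exact f g.
Proof.
by move=> gf h1 h2 h3; split; [apply: mono_chase|apply: exact_chase|apply: epi_chase].
Qed.

End Abelian.

(** * Opposite categories *)

Definition op (C : preadditive) : preadditive :=
  @Preadditive C (fun A B => hom B A) (fun A => idm A) (fun _ _ _ g f => f ∘ g)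
    (fun _ _ _ _ h g f => esym (compmA f g h)) (fun _ _ f => compm1 f)
    (fun _ _ f => comp1m f) (fun _ _ _ g g' f => compmDr f g g')
    (fun _ _ _ g f f' => compmDl f f' g).

Definition op_functor (C D : preadditive) (F : functor C D) :
    functor (op C) (op D) :=
  @Functor (op C) (op D) F (fun A B f => @fmap C D F B A f) (fun A => fmap1 F A)
    (fun A B E g f => fmapM F f g) (fun A B f g => fmapD F f g).

Lemma op_biproduct (C : preadditive) (A B S : C) (i1 : A ~> S) (i2 : B ~> S) p1 p2 :
  is_biproduct i1 i2 p1 p2 -> @is_biproduct (op C) A B S p1 p2 i1 i2.
Proof. by move=> [*]; split. Qed.

Lemma op_abelian (C : preadditive) : abelian C -> abelian (op C).
Proof.
move=> [[Z [z1 z2]] bip ker cok mon ep]; split.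
- by exists Z; split.
- move=> A B; have [S [i1 [i2 [p1 [p2 h]]]]] := bip A B.
  by exists S, p1, p2, i1, i2; apply: (op_biproduct h).
- by move=> A B f; apply: (cok B A f).
- by move=> A B f; apply: (ker B A f).
- by move=> A B f; apply: (ep B A f).
- by move=> A B f; apply: (mon B A f).
Qed.

(** Not an instance of the previous lemma: [op (op C)] has the same objects and
    morphisms as [C] by computation, but it is a different record. *)
Lemma op_abelian_inv (C : preadditive) : abelian (op C) -> abelian C.
Proof.
move=> [[Z [z1 z2]] bip ker cok mon ep]; split.
- by exists Z; split.
- move=> A B; have [S [i1 [i2 [p1 [p2 h]]]]] := bip A B.
  by exists S, p1, p2, i1, i2; case: h => *; split.
- by move=> A B f; apply: (cok B A f).
- by move=> A B f; apply: (ker B A f).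
- by move=> A B f; apply: (ep B A f).
- by move=> A B f; apply: (mon B A f).
Qed.

Section OpExact.
Context (C : preadditive) (abC : abelian C).

(** Dual of the existence of images. *)
Lemma coimage (A B K : C) (g : A ~> B) (k : K ~> A) :
  is_kernel g k -> exists (Q : C) (q : A ~> Q) (m : Q ~> B),
    [/\ is_cokernel k q, mono m & g = m ∘ q].
Proof. exact: (@exact_cokernel (op C) (op_abelian abC) _ _ _ g k). Qed.

(** Exactness is defined through a kernel of [g] and an epi; its dual, through a
    cokernel of [f] and a mono, is reached by factoring [g] through its
    coimage. *)
Lemma exact_op (A B D : C) (f : A ~> B) (g : B ~> D) :
  exact f g -> @exact (op C) D B A g f.
Proof.
move=> [K [k [e [hk ee ef]]]]; have [Q [q [m [hq mm eg]]]] := coimage hk.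
exists Q, q, m; split=> //; suff : is_cokernel f q by [].
apply: epi_cokernel (cokernel_epi hq) _; rewrite ef.
  by rewrite compmA (proj1 hq) comp0m.
by move=> W u; rewrite compmA => /(epi_eq0 ee); apply: cokernel_lift hq.
Qed.

Lemma short_exact_op (A B D : C) (f : A ~> B) (g : B ~> D) :
  short_exact f g -> @short_exact (op C) D B A g f.
Proof. by move=> [mf ex eg]; split=> //; apply: exact_op. Qed.

End OpExact.

Lemma exact_op_inv (C : preadditive) (abC : abelian C) (A B D : C)
    (f : A ~> B) (g : B ~> D) :
  @exact (op C) D B A g f -> exact f g.
Proof. exact: (@exact_op (op C) (op_abelian abC)). Qed.

Lemma short_exact_op_inv (C : preadditive) (abC : abelian C) (A B D : C)
    (f : A ~> B) (g : B ~> D) :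
  @short_exact (op C) D B A g f -> short_exact f g.
Proof. exact: (@short_exact_op (op C) (op_abelian abC)). Qed.

Lemma enough_injectives_op (C : preadditive) :
  enough_injectives C -> enough_projectives (op C).
Proof.
move=> iC V; have [I [i [injI mi]]] := iC V; exists I, i; split=> // X Y p f ep.
exact: (injI Y X p f ep).
Qed.

Lemma enough_projectives_op (C : preadditive) :
  enough_projectives C -> enough_injectives (op C).
Proof.
move=> pC V; have [P [p [prP ep]]] := pC V; exists P, p; split=> // X Y i f mi.
exact: (prP Y X i f mi).
Qed.

Lemma op_enough_injectives (C : preadditive) :
  enough_injectives (op C) -> enough_projectives C.
Proof. exact: enough_injectives_op. Qed.

(** * Short exact sequences built from others *)

Section Cone.
Context (C : preadditive) (abC : abelian C) (pC : enough_projectives C).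

Lemma biproduct_ext (A B S W : C) (i1 : A ~> S) (i2 : B ~> S) p1 p2 (u v : W ~> S) :
  is_biproduct i1 i2 p1 p2 -> p1 ∘ u = p1 ∘ v -> p2 ∘ u = p2 ∘ v -> u = v.
Proof.
move=> [_ _ _ _ e] e1 e2.
by rewrite -[u]comp1m -[v]comp1m -e !compmDl -!compmA e1 e2.
Qed.

Lemma biproduct_pair (A B S W : C) (i1 : A ~> S) (i2 : B ~> S) p1 p2
    (a : W ~> A) (b : W ~> B) :
  is_biproduct i1 i2 p1 p2 ->
  p1 ∘ (i1 ∘ a + i2 ∘ b) = a /\ p2 ∘ (i1 ∘ a + i2 ∘ b) = b.
Proof.
move=> [h11 h22 h12 h21 _]; split; rewrite compmDr !compmA.
  by rewrite h11 h12 comp1m comp0m addr0.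
by rewrite h22 h21 comp1m comp0m add0r.
Qed.

(** A morphism of short exact sequences that is the identity on the left end [K]
    has a bicartesian square X -> I, X -> Y, I -> Q, Y -> Q on the right; this is
    its exact sequence 0 -> X -> I + Y -> Q -> 0. *)
Lemma common_kernel_ses (K I Q X Y S : C) (f : K ~> I) (g : I ~> Q)
    (f' : K ~> X) (g' : X ~> Y) (h : X ~> I)
    (i1 : I ~> S) (i2 : Y ~> S) p1 p2 :
  short_exact f g -> short_exact f' g' -> h ∘ f' = f ->
  is_biproduct i1 i2 p1 p2 ->
  exists t : Y ~> Q,
    short_exact (i1 ∘ h + i2 ∘ g') (g ∘ p1 - t ∘ p2).
Proof.
move=> se se' ef bip; have /(short_exactP abC) [kf eg] := se.
have [mf' x' eg'] := se'.
have [|t et] := cokernel_lift (u := g ∘ h) (short_exact_cokernel abC se').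
  by rewrite -compmA ef (proj1 kf).
have [pk1 pk2] := biproduct_pair h g' bip.
exists t; set k := _ + _ in pk1 pk2 *; apply: (ses_chase abC pC).
- by rewrite compBm -!compmA pk1 pk2 et subrr.
- move=> P x prP kx.
  have g'x : g' ∘ x = 0 by rewrite -pk2 -compmA kx compm0.
  have [y ey] := exact_lift x' prP g'x; rewrite -ey.
  suff -> : y = 0 by rewrite compm0.
  apply: (mono_eq0 (kernel_mono kf)).
  by rewrite -ef -compmA ey -pk1 -compmA kx compm0.
- move=> P y prP cy; have [x0 ex0] := prP _ _ g' (p2 ∘ y) eg'.
  have [|z ez] := kernel_lift (u := p1 ∘ y - h ∘ x0) kf.
    by rewrite compmB !compmA -et -[t ∘ g' ∘ _]compmA ex0 compmA -compBm.
  exists (x0 + f' ∘ z); apply: (biproduct_ext bip); rewrite compmA.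
    by rewrite pk1 compmDr compmA ef ez addrC subrK.
  by rewrite pk2 compmDr compmA (exact_eq0 x') comp0m addr0.
move=> P z prP; have [y ey] := prP _ _ g z eg.
exists (i1 ∘ y); have [h11 _ _ h21 _] := bip.
rewrite compBm -!compmA !(compmA p1) !(compmA p2) h11 h21.
by rewrite comp1m comp0m compm0 subr0.
Qed.

(** The direct sum of 0 -> K -> X -> Y -> 0 and 0 -> I -> I -> 0 -> 0. *)
Lemma ses_add (K X Y I S S' : C) (f : K ~> X) (g : X ~> Y)
    (i1 : I ~> S) (i2 : K ~> S) p1 p2 (i1' : I ~> S') (i2' : X ~> S') p1' p2' :
  is_biproduct i1 i2 p1 p2 -> is_biproduct i1' i2' p1' p2' ->
  short_exact f g -> short_exact (i1' ∘ p1 + i2' ∘ (f ∘ p2)) (g ∘ p2').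
Proof.
move=> bip bip' /(short_exactP abC) [kf eg].
have [pk1 pk2] := biproduct_pair p1 (f ∘ p2) bip'; set k := _ + _ in pk1 pk2 *.
have [_ h22 _ _ _] := bip'.
apply/(short_exactP abC); split; last exact: epi_comp eg (epi_split h22).
apply: mono_kernel.
- by rewrite -compmA pk2 compmA (proj1 kf) comp0m.
- apply: mono0 => W u ku; apply: (biproduct_ext bip); rewrite compm0.
    by rewrite -pk1 -compmA ku compm0.
  by apply: (mono_eq0 (kernel_mono kf)); rewrite compmA -pk2 -compmA ku compm0.
move=> W u; rewrite -compmA => /(kernel_lift kf) [v ev].
have [e1 e2] := biproduct_pair (p1' ∘ u) v bip.
exists (i1 ∘ (p1' ∘ u) + i2 ∘ v); apply: (biproduct_ext bip'); rewrite compmA.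
  by rewrite pk1 e1.
by rewrite pk2 -compmA e2.
Qed.

Lemma injective_biproduct (A B S : C) (i1 : A ~> S) (i2 : B ~> S) p1 p2 :
  is_biproduct i1 i2 p1 p2 -> injective_object A -> injective_object B ->
  injective_object S.
Proof.
move=> [_ _ _ _ e] iA iB X Y i f mi.
have [h1 e1] := iA _ _ _ (p1 ∘ f) mi; have [h2 e2] := iB _ _ _ (p2 ∘ f) mi.
exists (i1 ∘ h1 + i2 ∘ h2).
by rewrite compmDl -!compmA e1 e2 !compmA -compmDl e comp1m.
Qed.

(** The third isomorphism theorem: for K <= X <= Z, the sequence
    0 -> X/K -> Z/K -> Z/X -> 0 is exact. *)
Lemma quotient_ses (K X Y Z W : C) (f : K ~> X) (g : X ~> Y)
    (j : X ~> Z) (w : Z ~> W) :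
  short_exact f g -> short_exact j w ->
  exists (Q : C) (q : Z ~> Q) (a : Y ~> Q) (b : Q ~> W),
    [/\ short_exact (j ∘ f) q, short_exact a b, a ∘ g = q ∘ j & b ∘ q = w].
Proof.
move=> sf sj; have /(short_exactP abC) [kf eg] := sf.
have /(short_exactP abC) [kj ew] := sj.
have mjf := mono_comp (kernel_mono kj) (kernel_mono kf).
have [Q [q sq]] := mono_short_exact abC mjf.
have cq := short_exact_cokernel abC sq; have /(short_exactP abC) [kq eq] := sq.
have [|a ea] := cokernel_lift (u := q ∘ j) (short_exact_cokernel abC sf).
  by rewrite -compmA (proj1 kq).
have [|b eb] := cokernel_lift (u := w) cq.
  by rewrite compmA (proj1 kj) comp0m.
exists Q, q, a, b; split=> //; apply: (ses_chase abC pC).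
- by apply: (epi_eq0 eg); rewrite -compmA ea compmA eb (proj1 kj).
- move=> P y prP ay; have [x ex] := prP _ _ g y eg.
  have [|k ek] := kernel_lift (u := j ∘ x) kq.
    by rewrite compmA -ea -compmA ex.
  rewrite -ex; have -> : x = f ∘ k.
    by apply: (kernel_mono kj); rewrite compmA.
  by rewrite compmA (proj1 kf) comp0m.
- move=> P y prP by0; have [z ez] := prP _ _ q y eq.
  have [|x ex] := kernel_lift (u := z) kj.
    by rewrite -eb -compmA ez.
  by exists (g ∘ x); rewrite compmA ea -compmA ex.
by move=> P y prP; have [z ez] := prP _ _ w y ew; exists (q ∘ z); rewrite compmA eb.
Qed.

End Cone.

(** * Resolutions *)

Section Splice.
Context (C : preadditive).

Definition splice_obj (X : C) (Y : nat -> C) (i : nat) : C :=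
  if i is j.+1 then Y j else X.

Definition lsplice (X : C) (Y : nat -> C) (u : Y 0 ~> X)
    (d : forall i, Y i.+1 ~> Y i) (i : nat) :
    splice_obj X Y i.+1 ~> splice_obj X Y i :=
  match i with 0 => u | j.+1 => d j end.

Definition rsplice (X : C) (Y : nat -> C) (u : X ~> Y 0)
    (d : forall i, Y i ~> Y i.+1) (i : nat) :
    splice_obj X Y i ~> splice_obj X Y i.+1 :=
  match i with 0 => u | j.+1 => d j end.

Context (abC : abelian C) (pC : enough_projectives C).

Lemma lsplice_exact (K X A : C) (f : K ~> X) (g : X ~> A) (Y : nat -> C)
    (d : forall i, Y i.+1 ~> Y i) (e : Y 0 ~> K) :
  short_exact f g -> left_exact_seq d e ->
  @left_exact_seq C A (splice_obj X Y) (lsplice (f ∘ e) d) g.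
Proof.
move=> /(short_exactP abC) [kf eg] [ee ex exs]; split=> //= [|[|i] //=].
  exact: kernel_exact kf ee erefl.
apply: (exact_chase abC pC) => [|P y prP].
  by rewrite -compmA (exact_eq0 ex) compm0.
by rewrite -compmA => /(mono_eq0 (kernel_mono kf)); apply: (exact_lift ex).
Qed.

Lemma rsplice_exact (V I K : C) (f : V ~> I) (g : I ~> K) (Y : nat -> C)
    (d : forall i, Y i ~> Y i.+1) (e : K ~> Y 0) :
  short_exact f g -> right_exact_seq d e ->
  @right_exact_seq C V (splice_obj I Y) (rsplice (e ∘ g) d) f.
Proof.
move=> [mf xfg eg] [me ex exs]; split=> //= [|[|i] //=].
- apply: (exact_chase abC pC) => [|P y prP].
    by rewrite -compmA (exact_eq0 xfg) compm0.
  by rewrite -compmA => /(mono_eq0 me); apply: exact_lift.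
- apply: (exact_chase abC pC) => [|P y prP].
    by rewrite compmA (exact_eq0 ex) comp0m.
  move=> /(exact_lift ex prP) [x <-]; have [z <-] := prP _ _ g x eg.
  by exists z; rewrite compmA.
Qed.

(** Cutting a resolution at its first syzygy, the converse of splicing. *)
Lemma left_exact_tail (A K : C) (X : nat -> C) (d : forall i, X i.+1 ~> X i)
    (e : X 0 ~> A) (k : K ~> X 0) :
  left_exact_seq d e -> is_kernel e k ->
  exists e' : X 1 ~> K,
    [/\ k ∘ e' = d 0%N, short_exact k e
      & @left_exact_seq C K (fun i => X i.+1) (fun i => d i.+1) e'].
Proof.
move=> [ee ex exs] hk; have [e' ek] := kernel_lift hk (exact_eq0 ex).
have mk := kernel_mono hk.
exists e'; split=> //; first exact: short_exact_kernel.
split=> //; first exact: exact_epi ex hk (esym ek).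
apply: (exact_chase abC pC) => [|P y prP ey].
  by apply: (mono_eq0 mk); rewrite compmA ek (exact_eq0 (exs _)).
by apply: (exact_lift (exs 0%N)) => //; rewrite -ek -compmA ey compm0.
Qed.

Lemma exact_zero_mono (Z A B : C) (f : Z ~> A) (g : A ~> B) :
  zero_object Z -> exact f g -> mono g.
Proof.
move=> [_ z] ex; apply: (mono_chase pC) => P x prP.
by move=> /(exact_lift ex prP) [y <-]; rewrite (z _ f) comp0m.
Qed.

Lemma mono_zero_exact (Z A B : C) (f : Z ~> A) (g : A ~> B) :
  zero_object Z -> mono g -> exact f g.
Proof.
move=> [_ z] mg; apply: (exact_chase abC pC) => [|P y prP /(mono_eq0 mg) ->].
  by rewrite (z _ f) compm0.
by exists 0; rewrite compm0.
Qed.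

(** A form of [left_dim_le] that allows induction on the length: one short exact
    sequence at a time. *)
Fixpoint res_dim (P : C -> Prop) (m : nat) (A : C) : Prop :=
  if m is m'.+1 then
    exists (K X : C) (f : K ~> X) (g : X ~> A),
      [/\ short_exact f g, P X & res_dim P m' K]
  else P A.

Lemma res_dim_left (P : C -> Prop) m A : res_dim P m A -> left_dim_le P m A.
Proof.
have [Z zZ] := abelian_zero abC; have [z1 z2] := zZ.
elim: m A => [|m IH] A /=.
  move=> PA; exists 0%N, (splice_obj A (fun=> Z)), (@lsplice A (fun=> Z) 0 (fun=> 0)), (idm A).
  split=> // [|[|i]//|[|i]//].
  have m1 := iso_mono (idm_iso A).
  split=> [||i]; first exact/iso_epi/idm_iso; first exact: mono_zero_exact.
  apply: mono_zero_exact => //; case: i => [|i] W u v _ /=;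
    by rewrite (z1 _ u) (z1 _ v).
move=> [K [X [f [g [fg PX /IH [k [Y [d [e [km ex PY zY]]]]]]]]]].
exists k.+1, (splice_obj X Y), (lsplice (f ∘ e) d), g; split=> //.
- exact: lsplice_exact.
- by move=> [|i] //= /PY.
- by move=> [|i] //= /zY.
Qed.

Lemma left_res_dim (P : C -> Prop) m A :
  object_class P -> left_dim_le P m A -> res_dim P m A.
Proof.
move=> [P0 Piso]; elim: m A => [|m IH] A [k [X [d [e [km ex PX zX]]]]].
all: have [K [j hj]] := abelian_kernel abC e.
all: have [e' [je' se ex']] := left_exact_tail ex hj.
  move: km; rewrite leqn0 => /eqP k0; rewrite {}k0 in PX zX.
  apply: (Piso _ _ e _ (PX 0%N isT)); have [ee x _] := ex.
  exact: mono_epi_iso abC _ _ _ (exact_zero_mono (zX 1%N isT) x) ee.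
exists K, (X 0%N), j, e; split=> //; first exact: PX.
case: k => [|k] in km PX zX *.
  apply: IH; exists 0%N, (fun i => X i.+1), (fun i => d i.+1), e'; split=> // i.
    by case: i => // _; apply/P0/zX.
  by move=> _; apply: zX.
apply: IH; exists k, (fun i => X i.+1), (fun i => d i.+1), e'; split=> // i hi.
  by apply: PX.
by apply: zX.
Qed.

End Splice.

(** * Extensions *)

Section Ext.
Context (C : preadditive) (abC : abelian C) (pC : enough_projectives C).

(** Vanishing of Ext^1(V, D). *)
Definition splits (V D : C) : Prop :=
  forall (E : C) (f : D ~> E) (g : E ~> V), short_exact f g ->
    exists s, g ∘ s = idm V.

Lemma biproduct_ses (A B S : C) (i1 : A ~> S) (i2 : B ~> S) p1 p2 :
  is_biproduct i1 i2 p1 p2 -> short_exact i1 p2.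
Proof.
move=> [h1 h2 h3 h4 e]; apply/(short_exactP abC); split; last exact: epi_split h2.
apply: mono_kernel => //; first exact: mono_split h1.
move=> W u pu; exists (p1 ∘ u).
by rewrite -[RHS]comp1m -e compmDl -!compmA pu compm0 addr0.
Qed.

(** A sequence 0 -> D -> E' -> V' -> 0 is pulled back along [c]; a section of
    the pullback is a lift of [c]. *)
Lemma splits_lift (V V' D E : C) (f : D ~> E) (g : E ~> V') (c : V ~> V') :
  splits V D -> short_exact f g -> exists s, g ∘ s = c.
Proof.
move=> spl se; have /(short_exactP abC) [kf eg] := se.
have [Q [p [q [sq jm lif]]]] := pullback abC g c.
have [|j [pj qj]] := lif _ f 0; first by rewrite compm0 (proj1 kf).
have [|s qs] := spl _ j q; last by exists (p ∘ s); rewrite compmA sq -compmA qs compm1.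
apply: (ses_chase abC pC) => //.
- move=> P x prP jx; apply: (mono_eq0 (kernel_mono kf)).
  by rewrite -pj -compmA jx compm0.
- move=> P y prP qy; have [|x fx] := kernel_lift (u := p ∘ y) kf.
    by rewrite compmA sq -compmA qy compm0.
  by exists x; apply: jm; rewrite compmA ?pj ?qj ?comp0m.
move=> P z prP; have [x gx] := prP _ _ g (c ∘ z) eg.
by have [w [_ ew]] := lif _ _ _ gx; exists w.
Qed.

Definition ses_obj (Z D E : C) : nat -> C := splice_obj E (splice_obj D (fun=> Z)).

Lemma ses_extension_exact (Z D E V : C) (f : D ~> E) (g : E ~> V) :
  zero_object Z -> short_exact f g ->
  @left_exact_seq C V (ses_obj Z D E)
    (@lsplice C E (splice_obj D (fun=> Z)) f (@lsplice C D (fun=> Z) 0 (fun=> 0))) g.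
Proof.
move=> zZ [mf ex eg]; split=> // [][|i] /=; first exact: mono_zero_exact.
apply: mono_zero_exact => //; case: zZ => z1 _.
by case: i => [|i] W u v _; rewrite (z1 _ u) (z1 _ v).
Qed.

Lemma ses_bounded (Z D E : C) :
  zero_object Z -> forall i, (1 < i)%N -> zero_object (ses_obj Z D E i).
Proof. by move=> zZ [|[|i]]. Qed.

Definition ses_extension (Z D E V : C) (f : D ~> E) (g : E ~> V)
    (zZ : zero_object Z) (se : short_exact f g) : extension 1 V D :=
  @Extension C 1 V D (ses_obj Z D E) _ g (idm D) (ses_extension_exact zZ se)
    (idm_iso D) (ses_bounded D E zZ).

Lemma extension1_ses (V D : C) (x : extension 1 V D) :
  short_exact (ext_d x 0 ∘ ext_end x) (ext_aug x).
Proof.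
have [ee ex exs] := ext_exact x; apply/(short_exactP abC); split=> //.
apply: kernel_iso (ext_end_iso x).
apply: (exact_mono_kernel abC _ ex).
exact: (exact_zero_mono pC (ext_bounded x (ltnSn 1)) (exs 0%N)).
Qed.

Definition aug_split (V D : C) (x : extension 1 V D) : Prop :=
  exists s, ext_aug x ∘ s = idm V.

(** Sections are carried forward by a morphism of extensions and retractions
    are carried back, so that splitting only depends on the Yoneda class. *)
Lemma extension_mor_split (V D : C) (x y : extension 1 V D) :
  extension_mor x y -> (aug_split x <-> aug_split y).
Proof.
move=> [f [fd faug fend]]; split=> [[s es]|[s es]].
  by exists (f 0%N ∘ s); rewrite compmA faug.
have [r [_ re _ _ _]] := split_section abC (extension1_ses y) es.
apply: (split_retraction abC (extension1_ses x) (r := r ∘ f 0%N)).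
by rewrite -compmA [f 0%N ∘ _]compmA -fd -compmA fend.
Qed.

Lemma Ext1_splits (V D : C) : Ext_zero 1 V D -> splits V D.
Proof.
move=> ext E f g se; have [Z zZ] := abelian_zero abC.
have [S [i1 [i2 [p1 [p2 bip]]]]] := abelian_biproduct abC D V.
have se' := biproduct_ses bip.
have equ (x y : extension 1 V D) : yoneda_equiv x y -> (aug_split x <-> aug_split y).
  elim=> {x y} [x y| | |].
  - exact: extension_mor_split.
  - by [].
  - by move=> x y _ [h1 h2]; split.
  - by move=> x y z _ [h1 h2] _ [h3 h4]; split; auto.
apply: (proj2 (equ _ _ (ext (ses_extension zZ se) (ses_extension zZ se')))).
by case: bip => _ e2 _ _ _; exists i2.
Qed.

Definition ext_over n (V V' D : C) (c : V ~> V')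
    (z : extension n V D) (x : extension n V' D) : Prop :=
  exists f : forall i, ext_obj z i ~> ext_obj x i,
    [/\ forall i, ext_d x i ∘ f i.+1 = f i ∘ ext_d z i,
        ext_aug x ∘ f 0%N = c ∘ ext_aug z
      & f n ∘ ext_end z = ext_end x].

(** The split extension D -> D + V -> V maps to any extension [x] over [c]: on [V]
    choose a lift of [c]. *)
Lemma split_ext_over (V D : C) : splits V D ->
  exists z : extension 1 V D, forall V' (x : extension 1 V' D) c, ext_over c z x.
Proof.
move=> spl; have [Z zZ] := abelian_zero abC.
have [S [i1 [i2 [p1 [p2 bip]]]]] := abelian_biproduct abC D V.
exists (ses_extension zZ (biproduct_ses bip)) => V' x c.
have se := extension1_ses x; have [s es] := splits_lift c spl se.
have [h11 h22 h12 h21 e] := bip.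
pose f i : ses_obj Z D S i ~> ext_obj x i :=
  match i with
  | 0 => ext_d x 0 ∘ ext_end x ∘ p1 + s ∘ p2
  | 1 => ext_end x
  | _ => 0
  end.
exists f; split=> [[|[|i]]||] /=.
- by rewrite compmDl -!compmA h11 h21 compm0 addr0 compm1.
- by rewrite !compm0.
- by rewrite compm0 comp0m.
- rewrite compmDr !compmA -[ext_aug x ∘ _ ∘ _]compmA es.
  by have [_ ex _] := se; rewrite (exact_eq0 ex) comp0m add0r.
- by rewrite compm1.
Qed.
End Ext.

Section HigherExt.
Context (C : preadditive) (abC : abelian C) (pC : enough_projectives C).

Lemma splice_bounded n (V D X : C) (z : extension n V D) i :
  (n.+1 < i)%N -> zero_object (splice_obj X (ext_obj z) i).
Proof. by case: i => // i; apply: (@ext_bounded _ _ _ _ z i). Qed.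

Definition splice_extension n (K X V D : C) (f : K ~> X) (g : X ~> V)
    (se : short_exact f g) (z : extension n K D) : extension n.+1 V D :=
  @Extension C n.+1 V D (splice_obj X (ext_obj z)) _ g (ext_end z)
    (lsplice_exact abC pC se (ext_exact z)) (ext_end_iso z)
    (@splice_bounded n K D X z).

(** Resolve [V] by projective objects, up to a syzygy in [W], and end with the
    split extension of this syzygy by [D]. Such an extension [z] maps to every
    extension [x] over every [c]: the projective objects lift [c] step by step,
    and the split end lifts because Ext^1 vanishes. Maps [c] other than the
    identity are needed for the induction. *)
Lemma syzygy_ext_over (W : C -> Prop) (D : C) :
  (forall V, W V -> splits V D) ->
  (forall (K P V : C) (f : K ~> P) (g : P ~> V),
     short_exact f g -> projective P -> W V -> W K) ->
  forall n V, W V -> exists z : extension n.+1 V D,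
    forall V' (x : extension n.+1 V' D) c, ext_over c z x.
Proof.
move=> spl kerW; elim=> [|n IH] V WV.
  exact: split_ext_over (spl _ WV).
have [P [p [prP ep]]] := pC V; have [K [k se]] := epi_short_exact abC ep.
have [z hz] := IH K (kerW _ _ _ _ _ se prP WV).
exists (splice_extension se z) => V' x c.
have [I [j hj]] := abelian_kernel abC (ext_aug x).
have [e [je sej exI]] := left_exact_tail abC pC (ext_exact x) hj.
pose x' := @Extension C n.+1 I D (fun i => ext_obj x i.+1)
  (fun i => ext_d x i.+1) e (ext_end x) exI (ext_end_iso x)
  (fun i => @ext_bounded _ _ _ _ x i.+1).
have [_ _ ex] := sej; have [q eq] := prP _ _ _ (c ∘ p) ex.
have [|d ed] := kernel_lift (u := q ∘ k) hj.
  have [_ xkp _] := se.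
  by rewrite compmA eq -compmA (exact_eq0 xkp) compm0.
have [f [fd faug fend]] := hz _ x' d.
pose f' i : splice_obj P (ext_obj z) i ~> ext_obj x i :=
  match i with 0 => q | i'.+1 => f i' end.
exists f'; split=> [[|i]||] //=.
by rewrite -je -compmA faug !compmA ed.
Qed.

(** Two extensions of [V] by [D] receive maps from the same third one. *)
Lemma syzygy_Ext_zero (W : C -> Prop) (D : C) :
  (forall V, W V -> splits V D) ->
  (forall (K P V : C) (f : K ~> P) (g : P ~> V),
     short_exact f g -> projective P -> W V -> W K) ->
  forall n V, (0 < n)%N -> W V -> Ext_zero n V D.
Proof.
move=> spl kerW [//|n] V _ WV x y.
have [z hz] := syzygy_ext_over spl kerW n WV.
have mor (t : extension n.+1 V D) : extension_mor z t.
  by have [f [fd faug fend]] := hz V t (idm V); exists f; rewrite faug comp1m.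
apply: (rst_trans _ _ _ z); last exact: rst_step (mor y).
exact: rst_sym (rst_step _ _ _ _ (mor x)).
Qed.

End HigherExt.

Lemma splits_op (C : preadditive) (abC : abelian C) (V D : C) :
  splits V D -> @splits (op C) D V.
Proof.
move=> spl E f g /(short_exact_op_inv abC) se; have [s es] := spl _ _ _ se.
by have [r [_ er _ _ _]] := split_section abC se es; exists r.
Qed.

(** Ext^1(K, D) = Ext^2(V, D) = Ext^1(V, D'), for a syzygy [K] of [V] and a
    cosyzygy [D'] of [D]. *)
Lemma syzygy_splits (C : preadditive) (W : C -> Prop) :
  abelian C -> enough_injectives C ->
  (forall I, injective_object I -> W I) -> closed_mono_cokernels W ->
  forall (K P V : C) (k : K ~> P) (p : P ~> V),
    short_exact k p -> projective P -> (forall D, W D -> splits V D) ->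
    forall D, W D -> splits K D.
Proof.
move=> abC iC injW cokW K P V k p sk prP spl D WD E f g se.
have [I [i [injI mi]]] := iC D; have [Q [q sq]] := mono_short_exact abC mi.
have [mf _ _] := se; have [h eh] := injI _ _ f i mf.
have /(short_exactP abC) [ki eq] := sq; have cg := short_exact_cokernel abC se.
have [|c ec] := cokernel_lift (u := q ∘ h) cg.
  by rewrite -compmA eh (proj1 ki).
have splQ := splits_op abC (spl _ (cokW _ _ _ _ _ sq WD (injW _ injI))).
(* [c] extends to [s : P -> Q] as Ext^1(V, Q) = 0, then lifts to [t : P -> I];
   correcting [h] by [t] gives a map into [D]. *)
have [s es] := splits_lift (op_abelian abC) (enough_injectives_op iC)
  (c : @hom (op C) Q K) splQ (short_exact_op abC sk).
rewrite /= in s es; have [t et] := prP _ _ q s eq.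
have [|r er] := kernel_lift (u := h - t ∘ k ∘ g) ki.
  by rewrite compmB !compmA et es ec subrr.
apply: (split_retraction abC se (r := r)); apply: (kernel_mono ki).
by rewrite compmA er compBm eh -compmA (proj1 cg) compm0 subr0 compm1.
Qed.

(** * Cotorsion pairs and duality *)

(** The part of a left cotorsion pair that concerns Ext^1 and resolutions. It
    dualizes readily, whereas a Yoneda extension is indexed from its right end;
    the higher Ext groups are recovered by dimension shifting. *)
Definition split_pair (C : preadditive) (n : nat) (P Q : C -> Prop) : Prop :=
  [/\ closed_summands P,
      forall V D, P V -> Q D -> splits V D
    & forall V : C, exists (K X : C) (f : K ~> X) (g : X ~> V),
        [/\ short_exact f g, P X & left_dim_le Q n K]].

Lemma left_split_pair (C : preadditive) n (P Q : C -> Prop) :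
  abelian C -> enough_projectives C -> (0 < n)%N ->
  left_cotorsion_pair n P Q -> split_pair n.-1 P Q.
Proof.
move=> abC pC n0 [sP ext app]; split=> // V D PV QD.
by apply: (Ext1_splits abC pC); apply: ext.
Qed.

Lemma right_exact_seq_op (C : preadditive) (abC : abelian C) (A : C)
    (X : nat -> C) (d : forall i, X i ~> X i.+1) (e : A ~> X 0) :
  right_exact_seq d e -> @left_exact_seq (op C) A X d e.
Proof. by move=> [me ex exs]; split=> // [|i]; apply: (exact_op abC). Qed.

Lemma op_right_exact_seq (C : preadditive) (abC : abelian C) (A : C)
    (X : nat -> C) (d : forall i, X i.+1 ~> X i) (e : X 0 ~> A) :
  @right_exact_seq (op C) A X d e -> left_exact_seq d e.
Proof. by move=> [me ex exs]; split=> // [|i]; apply: (exact_op_inv abC). Qed.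

Lemma op_left_exact_seq (C : preadditive) (abC : abelian C) (A : C)
    (X : nat -> C) (d : forall i, X i ~> X i.+1) (e : A ~> X 0) :
  @left_exact_seq (op C) A X d e -> right_exact_seq d e.
Proof. by move=> [me ex exs]; split=> // [|i]; apply: (exact_op_inv abC). Qed.

Lemma right_dim_le_op (C : preadditive) (abC : abelian C) (P : C -> Prop) m A :
  right_dim_le P m A -> @left_dim_le (op C) P m A.
Proof.
move=> [k [X [d [e [km ex PX zX]]]]]; exists k, X, d, e; split=> //.
  exact: right_exact_seq_op.
by move=> i /zX [z1 z2]; split.
Qed.

Lemma op_left_dim_le (C : preadditive) (abC : abelian C) (P : C -> Prop) m A :
  @left_dim_le (op C) P m A -> right_dim_le P m A.
Proof.
move=> [k [X [d [e [km ex PX zX]]]]]; exists k, X, d, e; split=> //.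
  exact: op_left_exact_seq.
by move=> i /zX [z1 z2]; split.
Qed.

Lemma right_split_pair (C : preadditive) n (P Q : C -> Prop) :
  abelian C -> enough_projectives C -> (0 < n)%N ->
  right_cotorsion_pair n P Q -> @split_pair (op C) n.-1 Q P.
Proof.
move=> abC pC n0 [sQ ext app]; split=> [A B S i1 i2 p1 p2|V D QV PD|V].
- by move=> [*]; apply: (sQ A B S p1 p2 i1 i2) => //; split.
- by apply: (splits_op abC); apply: (Ext1_splits abC pC); apply: ext.
have [X [K [f [g [se QX rK]]]]] := app V.
exists K, X, g, f; split=> //; first exact: short_exact_op.
exact: right_dim_le_op.
Qed.

Lemma split_pair_left (C : preadditive) n (P Q : C -> Prop) :
  abelian C -> enough_projectives C ->
  (forall V, projective V -> P V) -> closed_epi_kernels P ->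
  split_pair n.-1 P Q -> left_cotorsion_pair n P Q.
Proof.
move=> abC pC prP kerP [sP spl app]; split=> // i V D /andP [i0 _] PV QD.
apply: (syzygy_Ext_zero abC pC _ _ i0 PV) => [W PW|]; first exact: spl.
by move=> K R W f g se /prP PR; apply: kerP se PR.
Qed.

Lemma split_pair_right (C : preadditive) n (P Q : C -> Prop) :
  abelian C -> enough_projectives C -> enough_injectives C ->
  (forall V, injective_object V -> Q V) -> closed_mono_cokernels Q ->
  @split_pair (op C) n.-1 Q P -> right_cotorsion_pair n P Q.
Proof.
move=> abC pC iC injQ cokQ [sQ spl app].
split=> [A B S i1 i2 p1 p2|i V D /andP [i0 _] PV QD|V].
- by move=> [*]; apply: (sQ A B S p1 p2 i1 i2) => //; split.
- apply: (syzygy_Ext_zero abC pC (W := fun V => forall D, Q D -> splits V D)) i0 _.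
  + by move=> W; apply.
  + by move=> K R W f g; apply: syzygy_splits.
  by move=> D' QD'; apply: (splits_op (op_abelian abC)); apply: spl.
have [K [X [f [g [se QX rK]]]]] := app V.
exists X, K, g, f; split=> //; first exact: (short_exact_op_inv abC).
exact: op_left_dim_le.
Qed.

(** * Derived functors *)

Section Derived.
Context (A B : preadditive) (G : functor A B).
Context (abA : abelian A) (abB : abelian B).
Context (pA : enough_projectives A) (iA : enough_injectives A).
Context (pB : enough_projectives B) (exG : left_exact G).

(** A left exact functor preserves the kernel [k] of [q] and the mono [m], where
    [f = m ∘ q] is the factorization through the coimage. *)
Lemma fmap_kernel (X Y K : A) (f : X ~> Y) (k : K ~> X) :
  is_kernel f k -> is_kernel (fmap G f) (fmap G k).
Proof.
move=> hk.
have [Q [q [m [hq mm ->]]]] := coimage abA hk.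
have eq := cokernel_epi hq.
have kq : is_kernel q k by apply: mono_is_kernel (kernel_mono hk) hq.
have [mk xk] := exG (short_exact_kernel kq eq).
have [R [r /exG [mGm _]]] := mono_short_exact abA mm.
have [gk hgk] := exact_mono_kernel abB mk xk.
apply: mono_kernel => // [|W u]; first by rewrite fmapM -compmA gk compm0.
rewrite fmapM -compmA => /(mono_eq0 mGm) /hgk [v [e _]]; by exists v.
Qed.

Lemma fmap_mono (X Y : A) (f : X ~> Y) : mono f -> mono (fmap G f).
Proof.
by move=> /(mono_short_exact abA) [Q [q /(short_exactP abA) [/fmap_kernel /kernel_mono]]].
Qed.

(** Vanishing of the first derived functor at [K]: since [G] is left exact, only
    the right end of its values on short exact sequences is in question. *)
Definition keeps_epi (K : A) : Prop :=
  forall (X Y : A) (f : K ~> X) (g : X ~> Y), short_exact f g -> epi (fmap G g).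

(** Vanishing of the derived functor in degree [j.+1], on the [j]-th cosyzygy.
    Quantifying over all injective embeddings spares a comparison of the
    cosyzygies that belong to different choices. *)
Fixpoint deriv0 (j : nat) (K : A) : Prop :=
  if j is j'.+1 then
    forall (I Q : A) (f : K ~> I) (g : I ~> Q),
      injective_object I -> short_exact f g -> deriv0 j' Q
  else keeps_epi K.

(** Enough to test on one embedding in an injective object [I]: another sequence
    0 -> K -> X -> Y -> 0 maps to 0 -> K -> I -> Q -> 0, and [X] is then the
    kernel of a map from the sum of [I] and [Y] to [Q], which [G] preserves. *)
Lemma keeps_epi_test (K I Q : A) (f : K ~> I) (g : I ~> Q) :
  injective_object I -> short_exact f g -> epi (fmap G g) -> keeps_epi K.
Proof.
move=> injI se eGg X Y f' g' se'; have [mf' _ _] := se'.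
have [h ef] := injI _ _ f' f mf'.
have [S [i1 [i2 [p1 [p2 bip]]]]] := abelian_biproduct abA I Y.
have [t /(short_exactP abA) [hk _]] := common_kernel_ses abA pA se se' ef bip.
have [_ pk2] := biproduct_pair h g' bip; set k := _ + _ in pk2 hk *.
have [h11 h22 h12 h21 e] := bip.
apply: (epi_chase pB) => P y prP.
have [x ex] := prP _ _ (fmap G g) (fmap G t ∘ y) eGg.
have [|z ez] := kernel_lift (u := fmap G i1 ∘ x + fmap G i2 ∘ y) (fmap_kernel hk).
  rewrite compmDr !compmA -!fmapM !compBm -!compmA h11 h12 h21 h22.
  by rewrite !compm0 !compm1 subr0 sub0r fmapN compNm ex subrr.
exists z; rewrite -pk2 fmapM -compmA ez compmDr !compmA -!fmapM h21 h22.
by rewrite fmap0 fmap1 comp0m comp1m add0r.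
Qed.

Lemma keeps_epi_extension (K X Y : A) (f : K ~> X) (g : X ~> Y) :
  short_exact f g -> keeps_epi K -> keeps_epi Y -> keeps_epi X.
Proof.
move=> se hK hY Z W j w sj.
have [Q [q [a [b [sq sab _ <-]]]]] := quotient_ses abA pA se sj.
by rewrite fmapM; apply: epi_comp (hY _ _ _ _ sab) (hK _ _ _ _ sq).
Qed.

Lemma keeps_epi_summand (I K S : A) (i1 : I ~> S) (i2 : K ~> S) p1 p2 :
  is_biproduct i1 i2 p1 p2 -> keeps_epi S -> keeps_epi K.
Proof.
move=> bip hS X Y f g se.
have [S' [i1' [i2' [p1' [p2' bip']]]]] := abelian_biproduct abA I X.
have := hS _ _ _ _ (ses_add abA bip bip' se).
by rewrite fmapM => /epi_compl.
Qed.

Lemma deriv0_summand j (I K S : A) (i1 : I ~> S) (i2 : K ~> S) p1 p2 :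
  is_biproduct i1 i2 p1 p2 -> injective_object I -> deriv0 j S -> deriv0 j K.
Proof.
case: j => [|j] bip injI hS; first exact: keeps_epi_summand bip hS.
move=> J Q f g injJ se.
have [S' [i1' [i2' [p1' [p2' bip']]]]] := abelian_biproduct abA I J.
exact: hS (injective_biproduct bip' injI injJ) (ses_add abA bip bip' se).
Qed.

(** For an injective [I] that contains [K], with quotient [Q], there is an exact
    sequence 0 -> X -> I + Y -> Q -> 0, so closure under extensions applies to
    the middle term, of which [Y] is a summand. *)
Lemma deriv0_shift_of_extension j :
  (forall (K X Y : A) (f : K ~> X) (g : X ~> Y),
     short_exact f g -> deriv0 j K -> deriv0 j Y -> deriv0 j X) ->
  forall (K X Y : A) (f : K ~> X) (g : X ~> Y),
    short_exact f g -> deriv0 j X -> deriv0 j.+1 K -> deriv0 j Y.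
Proof.
move=> ext K X Y f g se hX hK; have [I [i [injI mi]]] := iA K.
have [Q [q sq]] := mono_short_exact abA mi.
have [mf _ _] := se; have [h eh] := injI _ _ f i mf.
have [S [i1 [i2 [p1 [p2 bip]]]]] := abelian_biproduct abA I Y.
have [t st] := common_kernel_ses abA pA sq se eh bip.
exact: deriv0_summand bip injI (ext _ _ _ _ _ st hX (hK _ _ _ _ injI sq)).
Qed.

(** Embed [X] in an injective [I]: the cosyzygy I/X of [X] is the quotient of the
    cosyzygy I/K of [K] by [Y], and the shift in degree [j] applies. *)
Lemma deriv0_extension j (K X Y : A) (f : K ~> X) (g : X ~> Y) :
  short_exact f g -> deriv0 j K -> deriv0 j Y -> deriv0 j X.
Proof.
elim: j K X Y f g => [|j IH] K X Y f g se hK hY; first exact: keeps_epi_extension se hK hY.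
move=> I Q i q injI si.
have [R [r [a [b [sr sab _ _]]]]] := quotient_ses abA pA se si.
exact: deriv0_shift_of_extension IH _ _ _ _ _ sab (hK _ _ _ _ injI sr) hY.
Qed.

(** In the long exact sequence of 0 -> K -> X -> Y -> 0, the value at [Y] lies
    between the value at [X] and the value at [K] one degree higher. *)
Lemma deriv0_shift j (K X Y : A) (f : K ~> X) (g : X ~> Y) :
  short_exact f g -> deriv0 j X -> deriv0 j.+1 K -> deriv0 j Y.
Proof. exact: deriv0_shift_of_extension (@deriv0_extension j) _ _ _ _ _. Qed.

(** The choices made at each step are turned into functions [I], [Q], [i], [q] of
    the object, so that cosyzygies can be iterated. *)
Lemma injective_resolution (V : A) :
  exists (I : nat -> A) (d : forall i, I i ~> I i.+1) (e : V ~> I 0),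
    (forall i, injective_object (I i)) /\ right_exact_seq d e.
Proof.
have step (K : A) : {t : {I : A & {Q : A & ((K ~> I) * (I ~> Q))%type}} |
    injective_object (projT1 t) /\
    short_exact (projT2 (projT2 t)).1 (projT2 (projT2 t)).2}.
  apply: constructive_indefinite_description.
  have [I [i [injI mi]]] := iA K; have [Q [q sq]] := mono_short_exact abA mi.
  by exists (existT _ I (existT _ Q (i, q))).
pose I K := projT1 (sval (step K)).
pose Q K : A := projT1 (projT2 (sval (step K))).
pose i K : K ~> I K := (projT2 (projT2 (sval (step K)))).1.
pose q K : I K ~> Q K := (projT2 (projT2 (sval (step K)))).2.
have se K : short_exact (i K) (q K) by case: (svalP (step K)).
have injI K : injective_object (I K) by case: (svalP (step K)).
pose z n := iter n Q V.
have ex K : exact (i K) (i (Q K) ∘ q K) /\ exact (i (Q K) ∘ q K) (i (Q (Q K)) ∘ q (Q K)).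
  have [_ x1 e1] := se K; have [m2 x2 _] := se (Q K); have [m3 _ _] := se (Q (Q K)).
  split; apply: (exact_chase abA pA).
  - by rewrite -compmA (exact_eq0 x1) compm0.
  - by move=> P y prP; rewrite -compmA => /(mono_eq0 m2); apply: exact_lift.
  - by rewrite -compmA (compmA (q _)) (exact_eq0 x2) comp0m compm0.
  move=> P y prP; rewrite -compmA => /(mono_eq0 m3) /(exact_lift x2 prP) [x <-].
  by have [w <-] := prP _ _ (q K) x e1; exists w; rewrite compmA.
exists (fun n => I (z n)), (fun n => i (Q (z n)) ∘ q (z n)), (i V).
split=> [n|]; first exact: injI.
by split=> [||n]; [case: (se V)|case: (ex V)|case: (ex (z n))].
Qed.

Lemma right_derived_shift j (V I K : A) (f : V ~> I) (g : I ~> K) :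
  injective_object I -> short_exact f g ->
  right_derived_zero G j.+2 V -> right_derived_zero G j.+1 K.
Proof.
move=> injI se h Y d e injY ex.
by apply: (h _ _ _ _ (rsplice_exact abA pA se ex)) => [[|i]] //=.
Qed.

Lemma right_derived_deriv0 j (V : A) : right_derived_zero G j.+1 V -> deriv0 j V.
Proof.
elim: j V => [|j IH] V h; last first.
  by move=> I Q f g injI se; apply/IH/(right_derived_shift injI se).
have [I [i [injI mi]]] := iA V; have [Q [q sq]] := mono_short_exact abA mi.
have [J [d [e [injJ ex]]]] := injective_resolution Q.
have xG : exact (fmap G (e ∘ q)) (fmap G (d 0%N)).
  by apply: (h _ _ _ _ (rsplice_exact abA pA sq ex)) => [[|n]] //=.
apply: (keeps_epi_test injI sq); apply: (epi_chase pB) => P y prP.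
have [me xe _] := ex.
have [|x ex'] := exact_lift (y := fmap G e ∘ y) xG prP.
  by rewrite compmA -fmapM (exact_eq0 xe) fmap0 comp0m.
by exists x; apply: (fmap_mono me); rewrite -ex' fmapM compmA.
Qed.

Lemma res_dim_deriv0 (M : A -> Prop) n m (K : A) :
  (forall j V, (j < n)%N -> M V -> deriv0 j V) ->
  res_dim M m K -> forall j, (j + m < n)%N -> deriv0 j K.
Proof.
move=> hM; elim: m K => [|m IH] K /= hK j; first by rewrite addn0 => /hM; apply.
have [K' [X [f [g [se MX /IH dK']]]]] := hK; rewrite addnS => jm.
apply: (deriv0_shift se); last exact: dK'.
by apply: hM => //; apply: leq_ltn_trans jm; rewrite -addnS leq_addr.
Qed.

End Derived.
(** * Comma categories *)

(** [E] is isomorphic to the category of arrows [b -> G a]: [glue φ] is the object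
    given by [φ], and [fstm], [sndm] are the components of a morphism in [A] and
    in [B]. The category is not fixed to be [right_comma G] because the opposite
    of [left_comma T] is also of this form. *)
Record comma_presentation (A B E : preadditive) (G : functor A B) := CommaPresentation {
  glue : forall (a : A) (b : B), (b ~> G a) -> E;
  fstm : forall a b (φ : b ~> G a) a' b' (φ' : b' ~> G a'),
    (glue φ ~> glue φ') -> (a ~> a');
  sndm : forall a b (φ : b ~> G a) a' b' (φ' : b' ~> G a'),
    (glue φ ~> glue φ') -> (b ~> b');
  glue_surj : forall V : E, exists a b (φ : b ~> G a), V = glue φ;
  fstm1 : forall a b (φ : b ~> G a), fstm (idm (glue φ)) = idm a;
  sndm1 : forall a b (φ : b ~> G a), sndm (idm (glue φ)) = idm b;
  fstmM : forall a b (φ : b ~> G a) a' b' (φ' : b' ~> G a')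
    a'' b'' (φ'' : b'' ~> G a'') (g : glue φ' ~> glue φ'') (f : glue φ ~> glue φ'),
    fstm (g ∘ f) = fstm g ∘ fstm f;
  sndmM : forall a b (φ : b ~> G a) a' b' (φ' : b' ~> G a')
    a'' b'' (φ'' : b'' ~> G a'') (g : glue φ' ~> glue φ'') (f : glue φ ~> glue φ'),
    sndm (g ∘ f) = sndm g ∘ sndm f;
  fstmD : forall a b (φ : b ~> G a) a' b' (φ' : b' ~> G a')
    (f g : glue φ ~> glue φ'), fstm (f + g) = fstm f + fstm g;
  sndmD : forall a b (φ : b ~> G a) a' b' (φ' : b' ~> G a')
    (f g : glue φ ~> glue φ'), sndm (f + g) = sndm f + sndm g;
  glue_square : forall a b (φ : b ~> G a) a' b' (φ' : b' ~> G a')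
    (f : glue φ ~> glue φ'), φ' ∘ sndm f = fmap G (fstm f) ∘ φ;
  glue_inj : forall a b (φ : b ~> G a) a' b' (φ' : b' ~> G a')
    (f g : glue φ ~> glue φ'), fstm f = fstm g -> sndm f = sndm g -> f = g;
  glue_full : forall a b (φ : b ~> G a) a' b' (φ' : b' ~> G a')
    (α : a ~> a') (β : b ~> b'), φ' ∘ β = fmap G α ∘ φ ->
    exists f : glue φ ~> glue φ', fstm f = α /\ sndm f = β }.

Section Glue.
Context (A B E : preadditive) (G : functor A B) (pE : comma_presentation E G).
Context (abA : abelian A) (abB : abelian B) (exG : left_exact G).

Local Notation glue := (glue pE).
Local Notation fstm := (fstm (c := pE)).
Local Notation sndm := (sndm (c := pE)).

Lemma fstm0 a b (φ : b ~> G a) a' b' (φ' : b' ~> G a') : 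
  fstm (0 : glue φ ~> glue φ') = 0.
Proof. by apply: (addrI (fstm (0 : glue φ ~> glue φ'))); rewrite -fstmD !addr0. Qed.

Lemma sndm0 a b (φ : b ~> G a) a' b' (φ' : b' ~> G a') : 
  sndm (0 : glue φ ~> glue φ') = 0.
Proof. by apply: (addrI (sndm (0 : glue φ ~> glue φ'))); rewrite -sndmD !addr0. Qed.

Lemma glue_mono a b (φ : b ~> G a) a' b' (φ' : b' ~> G a')
    (f : glue φ ~> glue φ') :
  mono (fstm f) -> mono (sndm f) -> mono f.
Proof.
move=> m1 m2 W; have [x [y [ψ ->]]] := glue_surj pE W => u v e.
by apply: glue_inj; [apply: m1; rewrite -!fstmM e|apply: m2; rewrite -!sndmM e].
Qed.

Lemma glue_epi a b (φ : b ~> G a) a' b' (φ' : b' ~> G a')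
    (f : glue φ ~> glue φ') :
  epi (fstm f) -> epi (sndm f) -> epi f.
Proof.
move=> m1 m2 W; have [x [y [ψ ->]]] := glue_surj pE W => u v e.
by apply: glue_inj; [apply: m1; rewrite -!fstmM e|apply: m2; rewrite -!sndmM e].
Qed.

Section Components.
Context (a a' a'' : A) (b b' b'' : B).
Context (φ : b ~> G a) (φ' : b' ~> G a') (φ'' : b'' ~> G a'').
Implicit Types (f : glue φ ~> glue φ') (g : glue φ' ~> glue φ'').

(** The components of the lifted map form a square because [G] preserves the mono
    [fstm f]. *)
Lemma glue_kernel f g :
  is_kernel (fstm g) (fstm f) -> is_kernel (sndm g) (sndm f) -> is_kernel g f.
Proof.
move=> k1 k2; apply: mono_kernel.
- apply: glue_inj; rewrite ?fstmM ?sndmM ?fstm0 ?sndm0; first by case: k1.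
  by case: k2.
- exact: glue_mono (kernel_mono k1) (kernel_mono k2).
move=> W; have [x [y [ψ ->]]] := glue_surj pE W => u gu.
have [|α eα] := kernel_lift (u := fstm u) k1; first by rewrite -fstmM gu fstm0.
have [|β eβ] := kernel_lift (u := sndm u) k2; first by rewrite -sndmM gu sndm0.
have [|v [v1 v2]] := @glue_full _ _ _ _ pE _ _ ψ _ _ φ α β.
  apply: (fmap_mono abA abB exG (kernel_mono k1)).
  by rewrite compmA -glue_square -compmA eβ glue_square -eα fmapM compmA.
by exists v; apply: glue_inj; rewrite ?fstmM ?sndmM ?v1 ?v2.
Qed.

Lemma glue_cokernel f g :
  is_cokernel (fstm f) (fstm g) -> is_cokernel (sndm f) (sndm g) ->
  is_cokernel f g.
Proof.
move=> k1 k2; apply: epi_cokernel.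
- apply: glue_inj; rewrite ?fstmM ?sndmM ?fstm0 ?sndm0; first by case: k1.
  by case: k2.
- exact: glue_epi (cokernel_epi k1) (cokernel_epi k2).
move=> W; have [x [y [ψ ->]]] := glue_surj pE W => u gu.
have [|α eα] := cokernel_lift (u := fstm u) k1; first by rewrite -fstmM gu fstm0.
have [|β eβ] := cokernel_lift (u := sndm u) k2; first by rewrite -sndmM gu sndm0.
have [|v [v1 v2]] := @glue_full _ _ _ _ pE _ _ φ'' _ _ ψ α β.
  apply: (cokernel_epi k2).
  by rewrite -compmA eβ glue_square -eα fmapM -!compmA glue_square.
by exists v; apply: glue_inj; rewrite ?fstmM ?sndmM ?v1 ?v2.
Qed.

End Components.

Lemma glue_kernel_exists a b (φ : b ~> G a) a' b' (φ' : b' ~> G a')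
    (f : glue φ ~> glue φ') :
  exists x y (ψ : y ~> G x) (k : glue ψ ~> glue φ),
    is_kernel (fstm f) (fstm k) /\ is_kernel (sndm f) (sndm k).
Proof.
have [x [k1 h1]] := abelian_kernel abA (fstm f).
have [y [k2 h2]] := abelian_kernel abB (sndm f).
have [|ψ eψ] := kernel_lift (u := φ ∘ k2) (fmap_kernel abA abB exG h1).
  by rewrite compmA -glue_square -compmA (proj1 h2) compm0.
have [k [e1 e2]] := glue_full pE (esym eψ).
by exists x, y, ψ, k; rewrite e1 e2.
Qed.

Lemma glue_cokernel_exists a b (φ : b ~> G a) a' b' (φ' : b' ~> G a')
    (f : glue φ ~> glue φ') :
  exists x y (ψ : y ~> G x) (q : glue φ' ~> glue ψ),
    is_cokernel (fstm f) (fstm q) /\ is_cokernel (sndm f) (sndm q).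
Proof.
have [x [q1 h1]] := abelian_cokernel abA (fstm f).
have [y [q2 h2]] := abelian_cokernel abB (sndm f).
have [|ψ eψ] := cokernel_lift (u := fmap G q1 ∘ φ') h2.
  by rewrite -compmA glue_square compmA -fmapM (proj1 h1) fmap0 comp0m.
have [q [e1 e2]] := glue_full pE eψ.
by exists x, y, ψ, q; rewrite e1 e2.
Qed.

Lemma glue_mono_components a b (φ : b ~> G a) a' b' (φ' : b' ~> G a')
    (f : glue φ ~> glue φ') : mono f -> mono (fstm f) /\ mono (sndm f).
Proof.
move=> mf; have [x [y [ψ [k [k1 k2]]]]] := glue_kernel_exists f.
have k0 : k = 0 by apply: (mono_eq0 mf); case: (glue_kernel k1 k2).
rewrite {}k0 fstm0 sndm0 in k1 k2.
split; apply: mono0 => W u; [move=> /(kernel_lift k1)|move=> /(kernel_lift k2)];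
  by move=> [v <-]; rewrite comp0m.
Qed.

Lemma glue_epi_components a b (φ : b ~> G a) a' b' (φ' : b' ~> G a')
    (f : glue φ ~> glue φ') : epi f -> epi (fstm f) /\ epi (sndm f).
Proof.
move=> ef; have [x [y [ψ [k [k1 k2]]]]] := glue_cokernel_exists f.
have k0 : k = 0 by apply: (epi_eq0 ef); case: (glue_cokernel k1 k2).
rewrite {}k0 fstm0 sndm0 in k1 k2.
split; apply: epi0 => W u; [move=> /(cokernel_lift k1)|move=> /(cokernel_lift k2)];
  by move=> [v <-]; rewrite compm0.
Qed.

(** Kernels and cokernels are computed componentwise, the former because [G]
    preserves kernels; normality of monos and epis is inherited from [A] and [B]
    as soon as these are known to be componentwise. *)
Lemma glue_abelian : abelian E.
Proof.
split.
- have [Z1 /zero_objectP z1] := abelian_zero abA.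
  have [Z2 /zero_objectP z2] := abelian_zero abB.
  exists (glue (0 : Z2 ~> G Z1)); apply/zero_objectP; apply: glue_inj.
    by rewrite fstm1 fstm0.
  by rewrite sndm1 sndm0.
- move=> V W; have [a [b [φ ->]]] := glue_surj pE V.
  have [a' [b' [φ' ->]]] := glue_surj pE W.
  have [S [i1 [i2 [p1 [p2 [h11 h22 h12 h21 e]]]]]] := abelian_biproduct abA a a'.
  have [S' [j1 [j2 [q1 [q2 [k11 k22 k12 k21 e']]]]]] := abelian_biproduct abB b b'.
  pose σ := fmap G i1 ∘ φ ∘ q1 + fmap G i2 ∘ φ' ∘ q2.
  have [|i [i_1 i_2]] := @glue_full _ _ _ _ pE _ _ φ _ _ σ i1 j1.
    by rewrite compmDl -!compmA k11 k21 !compm0 addr0 compm1.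
  have [|j [j_1 j_2]] := @glue_full _ _ _ _ pE _ _ φ' _ _ σ i2 j2.
    by rewrite compmDl -!compmA k22 k12 !compm0 add0r compm1.
  have [|p [p_1 p_2]] := @glue_full _ _ _ _ pE _ _ σ _ _ φ p1 q1.
    by rewrite compmDr !compmA -!fmapM h11 h12 fmap0 fmap1 !comp0m comp1m addr0.
  have [|q [q_1 q_2]] := @glue_full _ _ _ _ pE _ _ σ _ _ φ' p2 q2.
    by rewrite compmDr !compmA -!fmapM h21 h22 fmap0 fmap1 !comp0m comp1m add0r.
  exists (glue σ), i, j, p, q; split; apply: glue_inj;
    by rewrite ?fstmD ?sndmD ?fstmM ?sndmM ?fstm1 ?sndm1 ?fstm0 ?sndm0
      ?i_1 ?i_2 ?j_1 ?j_2 ?p_1 ?p_2 ?q_1 ?q_2.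
- move=> V W; have [a [b [φ ->]]] := glue_surj pE V.
  have [a' [b' [φ' ->]]] := glue_surj pE W => f.
  have [x [y [ψ [k [k1 k2]]]]] := glue_kernel_exists f.
  by exists (glue ψ), k; apply: glue_kernel.
- move=> V W; have [a [b [φ ->]]] := glue_surj pE V.
  have [a' [b' [φ' ->]]] := glue_surj pE W => f.
  have [x [y [ψ [k [k1 k2]]]]] := glue_cokernel_exists f.
  by exists (glue ψ), k; apply: glue_cokernel.
- move=> V W; have [a [b [φ ->]]] := glue_surj pE V.
  have [a' [b' [φ' ->]]] := glue_surj pE W => f /glue_mono_components [m1 m2].
  have [x [y [ψ [k [k1 k2]]]]] := glue_cokernel_exists f.
  by exists (glue ψ), k; apply: glue_kernel; apply: mono_is_kernel.
move=> V W; have [a [b [φ ->]]] := glue_surj pE V.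
have [a' [b' [φ' ->]]] := glue_surj pE W => f /glue_epi_components [m1 m2].
have [x [y [ψ [k [k1 k2]]]]] := glue_kernel_exists f.
by exists (glue ψ), k; apply: glue_cokernel; apply: epi_is_cokernel.
Qed.

Lemma glue_ses a b (φ : b ~> G a) a' b' (φ' : b' ~> G a')
    a'' b'' (φ'' : b'' ~> G a'') (f : glue φ ~> glue φ') (g : glue φ' ~> glue φ'') :
  short_exact f g <->
  short_exact (fstm f) (fstm g) /\ short_exact (sndm f) (sndm g).
Proof.
split=> [/(short_exactP glue_abelian) [kf /glue_epi_components [e1 e2]]|].
  have [x [y [ψ [k [k1 k2]]]]] := glue_kernel_exists g.
  have [t [t' [tt' t't]] ->] := kernel_unique (glue_kernel k1 k2) kf.
  have it1 : is_iso (fstm t).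
    by exists (fstm t'); rewrite -!fstmM tt' t't !fstm1.
  have it2 : is_iso (sndm t).
    by exists (sndm t'); rewrite -!sndmM tt' t't !sndm1.
  rewrite fstmM sndmM; split; apply: short_exact_kernel => //;
    exact: kernel_iso.
move=> [/(short_exactP abA) [k1 e1] /(short_exactP abB) [k2 e2]].
by apply: short_exact_kernel; [apply: glue_kernel|apply: glue_epi].
Qed.

(** The forgetful functor to the product of [A] and [B] preserves monos and has
    a right adjoint, which sends [(a, b)] to the projection of [G a + b] on [G a].
    Hence the right adjoint sends injective objects to injective objects. *)
Lemma glue_enough_injectives :
  enough_injectives A -> enough_injectives B -> enough_injectives E.
Proof.
move=> iA iB V; have [a [b [φ ->]]] := glue_surj pE V.
have [I [i [injI mi]]] := iA a; have [J [j [injJ mj]]] := iB b.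
have [S [i1 [i2 [p1 [p2 bip]]]]] := abelian_biproduct abB (G I) J.
exists (glue p1); have [e1 e2] := biproduct_pair (fmap G i ∘ φ) j bip.
have [u [u1 u2]] := glue_full pE e1.
exists u; split; last first.
  apply: glue_mono; rewrite ?u1 //; apply: (mono_compr (g := p2)).
  by rewrite u2 e2.
move=> V1 V2; have [x [y [θ ->]]] := glue_surj pE V1.
have [x' [y' [θ' ->]]] := glue_surj pE V2 => f g /glue_mono_components [m1 m2].
have [α eα] := injI _ _ (fstm f) (fstm g) m1.
have [β eβ] := injJ _ _ (sndm f) (p2 ∘ sndm g) m2.
have [h1 h2] := biproduct_pair (fmap G α ∘ θ') β bip.
have [v [v1 v2]] := glue_full pE h1.
exists v; apply: glue_inj; rewrite ?fstmM ?sndmM ?v1 ?v2 //.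
apply: (biproduct_ext bip); rewrite compmA ?h1 ?h2 //.
by rewrite -compmA glue_square compmA -fmapM eα glue_square.
Qed.

Context (pA : enough_projectives A) (iA : enough_injectives A).
Context (pB : enough_projectives B) (prE : enough_projectives E).
Context (X M : A -> Prop) (Y N : B -> Prop) (P Q : E -> Prop) (n : nat).
Context (clM : object_class M) (clN : object_class N).
Context (n_gt0 : (0 < n)%N).
Context (XM : split_pair n.-1 X M) (YN : split_pair n.-1 Y N).
Context (derG : forall j V, (1 <= j <= n)%N -> M V -> right_derived_zero G j V).
Context (glueP : forall a b (φ : b ~> G a), P (glue φ) <-> X a /\ Y b).
Context (glueQ : forall a b (φ : b ~> G a), Q (glue φ) <->
  [/\ M a, epi φ & exists (K : B) (k : K ~> b), is_kernel φ k /\ N K]).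
Context (extQ : closed_extensions (left_dim_le Q n.-1)).

Lemma glue_summands : closed_summands P.
Proof.
have [sX _ _] := XM; have [sY _ _] := YN.
move=> V W S; have [a [b [φ ->]]] := glue_surj pE V.
have [a' [b' [φ' ->]]] := glue_surj pE W.
have [a'' [b'' [φ'' ->]]] := glue_surj pE S => i1 i2 p1 p2 [h11 h22 h12 h21 e].
move=> /glueP [PX PY]; apply/glueP; split.
  apply: (sX _ a' _ (fstm i1) (fstm i2) (fstm p1) (fstm p2) _ PX).
  by split; rewrite -!fstmM -?fstmD ?h11 ?h12 ?h21 ?h22 ?e ?fstm0 ?fstm1.
apply: (sY _ b' _ (sndm i1) (sndm i2) (sndm p1) (sndm p2) _ PY).
by split; rewrite -!sndmM -?sndmD ?h11 ?h12 ?h21 ?h22 ?e ?sndm0 ?sndm1.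
Qed.

Lemma class_deriv0 j V : (j < n)%N -> M V -> deriv0 G j V.
Proof.
by move=> jn MV; apply: (right_derived_deriv0 abA abB pA iA pB exG); apply: derG.
Qed.

Lemma glue_idm_class K : M K -> Q (glue (idm (G K))).
Proof.
move=> MK; apply/glueQ; split=> //; first exact/iso_epi/idm_iso.
have [Z zZ] := abelian_zero abB; exists Z, 0; split; last exact: (proj1 clN).
apply: mono_kernel => [||W u]; first by rewrite compm0.
  by apply: mono0 => W u _; exact: (proj1 zZ).
by rewrite comp1m => ->; exists 0; rewrite comp0m.
Qed.

(** The right adjoint [K |-> (G K = G K)] of the projection on [A] sends
    resolutions by [M] to resolutions, because [G] keeps them exact. *)
Lemma glue_idm_res m K :
  (m < n)%N -> res_dim M m K -> res_dim Q m (glue (idm (G K))).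
Proof.
elim: m K => [|m IH] K mn /=; first exact: glue_idm_class.
move=> [K' [V [f [g [se MV rK']]]]].
have dK' : deriv0 G 0 K'.
  apply: (res_dim_deriv0 abA pA iA _ rK' (n := n)).
    by move=> j W; apply: class_deriv0.
  by rewrite add0n; apply: ltnW.
have lift a a' (h : a ~> a') : idm (G a') ∘ fmap G h = fmap G h ∘ idm (G a).
  by rewrite comp1m compm1.
have [f' [f1 f2]] := glue_full pE (lift _ _ f).
have [g' [g1 g2]] := glue_full pE (lift _ _ g).
exists (glue (idm (G K'))), (glue (idm (G V))), f', g'; split.
- apply/glue_ses; rewrite f1 f2 g1 g2; split=> //.
  apply/(short_exactP abB); split; last exact: dK' se.
  by apply: (fmap_kernel abA abB exG); have /(short_exactP abA) [] := se.
- exact: glue_idm_class.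
exact: IH (ltnW mn) rK'.
Qed.

(** The embedding [L |-> (L -> 0)] is exact, so it preserves resolutions. *)
Lemma glue_zero_res (Z : A) m L :
  zero_object Z -> res_dim N m L -> res_dim Q m (glue (0 : L ~> G Z)).
Proof.
move=> zZ.
have base L' : N L' -> Q (glue (0 : L' ~> G Z)).
  move=> NL; apply/glueQ; split; first exact: (proj1 clM).
    apply: epi0 => W u _; rewrite -[u]compm1 -fmap1.
    by move/zero_objectP: zZ => ->; rewrite fmap0 compm0.
  exists L', (idm L'); split=> //.
  apply: mono_kernel => [||W u _]; first by rewrite comp0m.
    exact/iso_mono/idm_iso.
  by exists u; rewrite comp1m.
elim: m L => [|m IH] L /=; first exact: base.
move=> [K' [V [f [g [se NV rK']]]]].
have lift b b' (h : b ~> b') :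
    (0 : b' ~> G Z) ∘ h = fmap G (idm Z) ∘ (0 : b ~> G Z).
  by rewrite comp0m compm0.
have [f' [f1 f2]] := glue_full pE (lift _ _ f).
have [g' [g1 g2]] := glue_full pE (lift _ _ g).
exists (glue (0 : K' ~> G Z)), (glue (0 : V ~> G Z)), f', g'; split.
- apply/glue_ses; rewrite f1 f2 g1 g2; split=> //; apply: short_exact_kernel.
    apply: mono_kernel => [||W u _]; last by exists u; rewrite comp1m.
      by move/zero_objectP: (zZ) => e; rewrite e compm0.
    exact/iso_mono/idm_iso.
  exact/iso_epi/idm_iso.
- exact: base.
exact: IH rK'.
Qed.

(** The first component is covered by its approximation, the second one by the
    approximation of the pullback [B'], so that the structure maps match. *)
Lemma glue_cover (V : E) : exists (S U : E) (f : S ~> U) (g : U ~> V),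
  [/\ short_exact f g, P U & left_dim_le Q n.-1 S].
Proof.
have abE := glue_abelian.
have nn : (n.-1 < n)%N by rewrite prednK.
have [a [b [φ ->]]] := glue_surj pE V.
have [_ _ /(_ a) [K [X0 [f [g [sfg XX0 rK]]]]]] := XM.
have {}rK := left_res_dim abA pA clM rK.
have dK : deriv0 G 0 K.
  apply: (res_dim_deriv0 abA pA iA _ rK (n := n)) => //.
  by move=> j W; apply: class_deriv0.
have eGg := dK _ _ _ _ sfg.
have /(short_exactP abA) [kf eg] := sfg; have kGf := fmap_kernel abA abB exG kf.
have [B' [π1 [π2 [sq jm lif]]]] := pullback abB φ (fmap G g).
have eπ1 : epi π1.
  apply: (epi_chase pB) => R y prR; have [x ex] := prR _ _ _ (φ ∘ y) eGg.
  by have [w [ew _]] := lif _ _ _ (esym ex); exists w.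
have [_ _ /(_ B') [L [Y0 [l [h [slh YY0 rL]]]]]] := YN.
have {}rL := left_res_dim abB pB clN rL.
have /(short_exactP abB) [kl eh] := slh.
have [|p [p1 p2]] := @glue_full _ _ _ _ pE _ _ (π2 ∘ h) _ _ φ g (π1 ∘ h).
  by rewrite !compmA sq.
have ep : epi p by apply: glue_epi; rewrite ?p1 ?p2 //; apply: epi_comp.
have [k2K [σ hσ]] := abelian_kernel abB (π1 ∘ h).
have [|θ eθ] := kernel_lift (u := π2 ∘ h ∘ σ) kGf.
  by rewrite !compmA -sq -(compmA φ π1) -(compmA φ) (proj1 hσ) compm0.
have [k [k1 k2]] := glue_full pE (esym eθ).
exists (glue θ), (glue (π2 ∘ h)), k, p; split; last 1 first.
- have [Z zZ] := abelian_zero abA.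
  (* 0 -> (L -> 0) -> θ -> (G K = G K) -> 0 *)
  have [|l' el'] := kernel_lift (u := l) hσ.
    by rewrite -compmA (proj1 kl) compm0.
  have [|u [u1 u2]] := @glue_full _ _ _ _ pE _ _ (0 : L ~> G Z) _ _ θ 0 l'.
    rewrite compm0; apply: (kernel_mono kGf).
    by rewrite compm0 compmA eθ -compmA el' -compmA (proj1 kl) compm0.
  have [|v [v1 v2]] := @glue_full _ _ _ _ pE _ _ θ _ _ (idm (G K)) (idm K) θ.
    by rewrite fmap1.
  have resQ := res_dim_left abE prE.
  apply: (extQ _ (resQ _ _ _ (glue_zero_res zZ rL)) (resQ _ _ _ (glue_idm_res nn rK))).
  apply/(@glue_ses _ _ _ _ _ _ _ _ _ u v); rewrite u1 u2 v1 v2; split.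
    apply: short_exact_kernel; last exact/iso_epi/idm_iso.
    apply: mono_kernel => [||W x].
    + by rewrite compm0.
    + by apply: mono0 => W x _; apply: (proj1 zZ).
    by rewrite comp1m => ->; exists 0; rewrite compm0.
  apply: (ses_chase abB pB).
  + apply: (kernel_mono kGf).
    by rewrite compm0 compmA eθ -compmA el' -compmA (proj1 kl) compm0.
  + move=> R x prR lx; apply: (mono_eq0 (kernel_mono kl)).
    by rewrite -el' -compmA lx compm0.
  + move=> R y prR θy; have [|x ex] := kernel_lift (u := σ ∘ y) kl.
      apply: jm; rewrite compm0 !compmA; first by rewrite (proj1 hσ) comp0m.
      by rewrite -eθ -compmA θy compm0.
    by exists x; apply: (kernel_mono hσ); rewrite compmA el'.
  move=> R y prR; have [|w [w1 w2]] := lif _ 0 (fmap G f ∘ y).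
    by rewrite compm0 compmA (proj1 kGf) comp0m.
  have [z ez] := prR _ _ h w eh.
  have [|x ex] := kernel_lift (u := z) hσ; first by rewrite -compmA ez.
  exists x; apply: (kernel_mono kGf).
  by rewrite compmA eθ -!compmA ex ez.
- apply: short_exact_kernel => //; by apply: glue_kernel; rewrite ?k1 ?k2 ?p1 ?p2.
by apply/glueP.
Qed.

(** Ext^1 of the second component of [V] is known to vanish on the kernel of the
    structure map of [D] only, so the section of that component is looked for in an extension
    by this kernel. *)
Lemma glue_splits (V D : E) : P V -> Q D -> splits V D.
Proof.
have [a [b [θ ->]]] := glue_surj pE V; have [a' [b' [φ ->]]] := glue_surj pE D.
move=> /glueP [Xa Yb] /glueQ [Ma eφ [K [k [hk NK]]]].
move=> W; have [a'' [b'' [ψ ->]]] := glue_surj pE W => f g /glue_ses [s1 s2].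
have [_ extA _] := XM; have [_ extB _] := YN.
have [s gs] := extA _ _ Xa Ma _ _ _ s1.
have /(short_exactP abA) [kf1 _] := s1; have /(short_exactP abB) [kf2 eg2] := s2.
have kGf := fmap_kernel abA abB exG kf1.
(* A section [t] of the second component is compatible with [s] exactly when
   [δ ∘ t = 0]. *)
have [|δ eδ] := kernel_lift (u := ψ - fmap G s ∘ θ ∘ sndm g) kGf.
  by rewrite compmB -glue_square !compmA -fmapM gs fmap1 comp1m subrr.
have δf : δ ∘ sndm f = φ.
  apply: (kernel_mono kGf); rewrite compmA eδ compBm -glue_square.
  by rewrite -[fmap G s ∘ θ ∘ _ ∘ _]compmA (proj1 kf2) compm0 subr0.
have [R [w hw]] := abelian_kernel abB δ.
have [|j ej] := kernel_lift (u := sndm f ∘ k) hw.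
  by rewrite compmA δf (proj1 hk).
have [|s' es'] := extB _ _ Yb NK _ j (sndm g ∘ w).
  apply: (ses_chase abB pB).
  - by rewrite -compmA ej compmA (proj1 kf2) comp0m.
  - move=> T x prT jx; apply: (mono_eq0 (mono_comp (kernel_mono kf2) (kernel_mono hk))).
    by rewrite -ej -compmA jx compm0.
  - move=> T y prT; rewrite -compmA => /(kernel_lift kf2) [d ed].
    have [|x ex] := kernel_lift (u := d) hk.
      by rewrite -δf -compmA ed compmA (proj1 hw) comp0m.
    by exists x; apply: (kernel_mono hw); rewrite compmA ej -compmA ex.
  move=> T z prT; have [e ee] := prT _ _ _ z eg2; have [d ed] := prT _ _ φ (δ ∘ e) eφ.
  have [|y ey] := kernel_lift (u := e - sndm f ∘ d) hw.
    by rewrite compmB compmA δf ed subrr.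
  by exists y; rewrite -compmA ey compmB compmA (proj1 kf2) comp0m subr0.
have [|t [t1 t2]] := @glue_full _ _ _ _ pE _ _ θ _ _ ψ s (w ∘ s').
  apply/eqP; rewrite -subr_eq0; apply/eqP.
  have <- : fmap G (fstm f) ∘ δ ∘ (w ∘ s') = 0.
    by rewrite -compmA [δ ∘ _]compmA (proj1 hw) comp0m compm0.
  by rewrite eδ compBm -!compmA (compmA (sndm g)) es' compm1.
by exists t; apply: glue_inj; rewrite ?fstmM ?sndmM ?fstm1 ?sndm1 ?t1 ?t2 ?compmA.
Qed.

(** A projective object is a summand of any object that covers it. *)
Lemma glue_projective (V : E) : projective V -> P V.
Proof.
move=> prV; have [S [U [f [g [se PU _]]]]] := glue_cover V.
have [_ _ eg] := se; have [s gs] := prV _ _ g (idm V) eg.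
have [r bip] := split_section glue_abelian se gs.
exact: glue_summands bip PU.
Qed.

Theorem glue_split_pair : split_pair n.-1 P Q.
Proof. by split; [exact: glue_summands|exact: glue_splits|exact: glue_cover]. Qed.

End Glue.

(** * The two comma categories *)

Definition right_comma_presentation (A B : preadditive) (G : functor A B) :
  comma_presentation (right_comma G) G.
Proof.
apply: (@CommaPresentation A B (right_comma G) G
  (fun a b φ => @CommaObj B A B (id_functor B) G b a φ)
  (fun _ _ _ _ _ _ f => (comma_pair f).2)
  (fun _ _ _ _ _ _ f => (comma_pair f).1)) => //.
- by case=> b a φ; exists a, b, φ.
- by move=> a b φ a' b' φ' f; have /eqP := comma_pairP f.
- by move=> a b φ a' b' φ' f g e1 e2; apply: comma_homP.
move=> a b φ a' b' φ' α β /eqP sq.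
pose V := @CommaObj B A B (id_functor B) G b a φ.
pose V' := @CommaObj B A B (id_functor B) G b' a' φ'.
by exists (@CommaHom B A B (id_functor B) G V V' (β, α) sq).
Defined.

Definition left_comma_presentation (A B : preadditive) (T : functor B A) :
  comma_presentation (op (left_comma T)) (op_functor T).
Proof.
apply: (@CommaPresentation (op B) (op A) (op (left_comma T)) (op_functor T)
  (fun b a φ => @CommaObj B A A T (id_functor A) b a φ)
  (fun _ _ _ _ _ _ f => (comma_pair f).1)
  (fun _ _ _ _ _ _ f => (comma_pair f).2)) => //.
- by case=> b a φ; exists b, a, φ.
- by move=> b a φ b' a' φ' f; have /eqP := comma_pairP f.
- by move=> b a φ b' a' φ' f g e1 e2; apply: comma_homP.
move=> b a φ b' a' φ' α β /esym/eqP sq.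
pose V := @CommaObj B A A T (id_functor A) b a φ.
pose V' := @CommaObj B A A T (id_functor A) b' a' φ'.
by exists (@CommaHom B A A T (id_functor A) V' V (α, β) sq).
Defined.

Lemma right_exact_op (A B : preadditive) (T : functor B A) :
  abelian A -> abelian B -> right_exact T -> left_exact (op_functor T).
Proof.
move=> abA abB exT X Y Z f g /(short_exact_op_inv abB) /exT [ex ep].
by split=> //; apply: (exact_op abA).
Qed.

Lemma left_derived_zero_op (A B : preadditive) (T : functor B A) j V :
  abelian A -> abelian B ->
  left_derived_zero T j.+1 V -> right_derived_zero (op_functor T) j.+1 V.
Proof.
move=> abA abB h I d e injI ex; apply: (exact_op abA).
apply: (h I d e); last exact: op_right_exact_seq.
by move=> i X Y p f ep; apply: (injI i Y X p f ep).
Qed.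

Lemma op_object_class (C : preadditive) (P : C -> Prop) :
  object_class P -> @object_class (op C) P.
Proof.
move=> [P0 Pi]; split=> [Z [z1 z2]|A B f [g [gf fg]]]; first by apply: P0.
by apply: (Pi _ _ g); exists f.
Qed.

Theorem theorem3p11
  (A B : preadditive) (T : functor B A) (G : functor A B)
  (X M : A -> Prop) (Y N : B -> Prop) (n : nat)
  (abelA : abelian A) (abelB : abelian B)
  (projA : enough_projectives A) (injA : enough_injectives A)
  (projB : enough_projectives B) (injB : enough_injectives B)
  (exT : right_exact T) (exG : left_exact G)
  (clX : object_class X) (clM : object_class M)
  (clY : object_class Y) (clN : object_class N)
  (n_ge1 : (1 <= n)%N) :
  (enough_projectives (right_comma G) ->
   left_cotorsion_pair n X M ->
   left_cotorsion_pair n Y N ->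
   (forall j V, (1 <= j <= n)%N -> M V -> right_derived_zero G j V) ->
   resolving (right_comma_class G X Y) ->
   closed_extensions (left_dim_le (frakD G M N) n.-1) ->
   left_cotorsion_pair n (right_comma_class G X Y) (frakD G M N))
  /\
  (enough_injectives (left_comma T) ->
   right_cotorsion_pair n X M ->
   right_cotorsion_pair n Y N ->
   (forall j V, (1 <= j <= n)%N -> Y V -> left_derived_zero T j V) ->
   coresolving (left_comma_class T M N) ->
   closed_extensions (right_dim_le (frakB T X Y) n.-1) ->
   right_cotorsion_pair n (frakB T X Y) (left_comma_class T M N)).
Proof.
split=> [prE XM YN derG [_ kerP] extQ|inE XM YN derT [_ cokP] extQ].
  pose pE := right_comma_presentation G.
  have abE := glue_abelian pE abelA abelB exG.
  have {}XM := left_split_pair abelA projA n_ge1 XM.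
  have {}YN := left_split_pair abelB projB n_ge1 YN.
  have clP a b (φ : b ~> G a) :
    right_comma_class G X Y (glue pE φ) <-> X a /\ Y b by [].
  have clQ a b (φ : b ~> G a) : frakD G M N (glue pE φ) <->
    [/\ M a, epi φ & exists (K : B) (k : K ~> b), is_kernel φ k /\ N K] by [].
  apply: (split_pair_left abE prE _ kerP).
  move=> V; exact: (glue_projective abelA abelB exG projA injA projB prE
      clM clN n_ge1 XM YN derG clP clQ extQ).
  exact: (glue_split_pair abelA abelB exG projA injA projB prE
    clM clN n_ge1 XM YN derG clP clQ extQ).
pose pE := left_comma_presentation T.
have exT' := right_exact_op abelA abelB exT.
have abA' := op_abelian abelA; have abB' := op_abelian abelB.
have pA' := enough_injectives_op injA; have iA' := enough_projectives_op projA.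
have pB' := enough_injectives_op injB; have iB' := enough_projectives_op projB.
have abE' := glue_abelian pE abB' abA' exT'.
have abL : abelian (left_comma T) := op_abelian_inv abE'.
have prL : enough_projectives (left_comma T).
  apply: op_enough_injectives.
  exact: (glue_enough_injectives pE abB' abA' exT' iB' iA').
have prE' := enough_injectives_op inE.
have XM' := right_split_pair abelA projA n_ge1 XM.
have YN' := right_split_pair abelB projB n_ge1 YN.
have clP b a (φ : @hom (op A) a (op_functor T b)) :
  left_comma_class T M N (glue pE φ) <-> N b /\ M a by split=> [[]|[]].
have clQ b a (φ : @hom (op A) a (op_functor T b)) : frakB T X Y (glue pE φ) <->
  [/\ Y b, @epi (op A) _ _ φ
    & exists (K : op A) (k : @hom (op A) K a), @is_kernel (op A) _ _ φ K k /\ X K].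
  by [].
have derG j V : (1 <= j <= n)%N -> Y V -> right_derived_zero (op_functor T) j V.
  by case: j => // j hj YV; apply: (left_derived_zero_op abelA abelB); apply: derT.
have extQ' : closed_extensions
    (@left_dim_le (op (left_comma T)) (frakB T X Y) n.-1).
  move=> U V W f g /(short_exact_op_inv abL) se dU dW.
  apply: (right_dim_le_op abL).
  by apply: (extQ _ _ _ _ _ se); apply: (op_left_dim_le abL).
have clM' := op_object_class clY; have clN' := op_object_class clX.
apply: (split_pair_right abL prL inE _ cokP).
  move=> V injV.
  have prV : @projective (op (left_comma T)) V.
    by move=> V1 V2 p f; apply: injV.
  exact: (glue_projective abB' abA' exT' pB' iB' pA' prE' clM' clN' n_ge1
    YN' XM' derG clP clQ extQ' prV).
exact: (glue_split_pair abB' abA' exT' pB' iB' pA' prE' clM' clN' n_ge1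
  YN' XM' derG clP clQ extQ').
Qed.
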